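(* Let $f$ be a complex polynomial and let $z_0,w_0\in\mathbb{C}$. Suppose that the branch of the inverse $f^{-1}_{z_0}$ is analytic on the wedge $\mathcal{W}_{A,w_0}$, with $0<A\le\pi/2$, and let $h\le\frac{\sin A}{19}$. Suppose also that $|f(z_0)-w_0|<h|w_0|/2$, and define, for $n\ge 0$, $$w_n=(1-h)^nw_0,\qquad z_{n+1}=z_n-\frac{f(z_n)-w_{n+1}}{f'(z_n)}.$$ Then for all $n\ge 0$, $$|f(z_n)-w_n|\le \frac{h|w_n|}{2}\qquad\text{and}\qquad z_{n+1}\in f_{z_0}^{-1}\big(\mathcal{W}_{A,w_n}\big).$$
   Context: For $w\ne 0$ and $A>0$, the wedge is $\mathcal{W}_{A,w}=\{z\in\mathbb{C} : 0<|z|<2|w|,\ \arg w-A<\arg z<\arg w+A\}$ (arguments taken modulo $2\pi$). For a point $z_0$ with $f'(z_0)\ne0$, $f^{-1}_{z_0}$ denotes the branch of the inverse of $f$ taking $f(z_0)$ to $z_0$, that is, the analytic function with $f\circ f^{-1}_{z_0}=\mathrm{id}$ and $f^{-1}_{z_0}(f(z_0))=z_0$; that it is analytic on the wedge means that this branch extends to a (single-valued) analytic function on the wedge. *)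

(* Defs.v *)
From HB Require Import structures.
From mathcomp Require Import all_boot all_order all_algebra.
From mathcomp Require Import all_classical all_reals all_analysis.
From mathcomp Require Import complex.

Set Implicit Arguments.
Unset Strict Implicit.
Unset Printing Implicit Defensive.

Import Order.TTheory GRing.Theory Num.Theory.
Import numFieldNormedType.Exports.

Local Open Scope classical_set_scope.
Local Open Scope complex_scope.
Local Open Scope ring_scope.

(* Norms on R[i] take their values in R[i] itself, as nonnegative reals;
   x < y in R[i] means that x and y have the same imaginary part and that
   Re x < Re y. *)

(* t is one of the values of arg z, which is multivalued modulo 2 pi. *)
Definition is_arg (R : realType) (z : R[i]) (t : R) : Prop :=
  z = `|z| * (cos t +i* sin t).

Definition wedge (R : realType) (A : R) (w : R[i]) : set R[i] :=
  [set z | 0 < `|z| < 2 * `|w| /\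
    exists a t : R, [/\ is_arg w a, is_arg z t & a - A < t < a + A]].

(* Complex differentiability at every point of D. The alias R[i]^o carries the
   structure of normed space over R[i], so the scalar increments in [derivable]
   are complex numbers. *)
Definition analytic_on (R : realType) (D : set R[i]) (g : R[i] -> R[i]) : Prop :=
  forall w, D w -> derivable (g : R[i]^o -> R[i]^o) w 1.

(* g is, on D, the analytic branch of the inverse of f that takes f z0 to z0.
   Meaningful when f z0 lies in D; the values of g outside D are irrelevant. *)
Definition inverse_branch_on (R : realType) (f : {poly R[i]}) (z0 : R[i])
    (D : set R[i]) (g : R[i] -> R[i]) : Prop :=
  [/\ f^`().[z0] != 0, analytic_on D g, (forall w, D w -> f.[g w] = w)
    & g f.[z0] = z0].

Definition guide (R : realType) (h : R) (w0 : R[i]) (n : nat) : R[i] :=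
  (1 - h%:C) ^+ n * w0.

Fixpoint guided_newton (R : realType) (f : {poly R[i]}) (h : R) (w0 z0 : R[i])
    (n : nat) : R[i] :=
  if n is m.+1 then
    let z := guided_newton f h w0 z0 m in
    z - (f.[z] - guide h w0 m.+1) / f^`().[z]
  else z0.

(* Main.v *)
Require Import Defs.
From mathcomp Require Import all_boot all_order all_algebra.
From mathcomp Require Import all_classical all_reals all_analysis.
From mathcomp Require Import complex.
From mathcomp Require Import ring lra zify.

Set Implicit Arguments.
Unset Strict Implicit.
Unset Printing Implicit Defensive.

Import Order.TTheory GRing.Theory Num.Theory.
Import numFieldNormedType.Exports.

Local Open Scope classical_set_scope.
Local Open Scope complex_scope.
Local Open Scope ring_scope.

(** The wedge of half-opening A about w contains the disc of centre w and radius
|w| sin A, hence of radius 19 H where H = h |w|. If f(z_n) is within H/2 of w_n,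
the branch g is therefore holomorphic and injective in the disc of radius 18.5 H
about f(z_n), while the step asked of Newton's method has length at most 1.5 H.
Distortion theory for injective functions says that f is so close to linear along
the step that the error is at most 0.46 H, which is less than h |w_{n+1}| / 2
since 1 - h >= 18/19 (newton_step). Induction on n gives the theorem.

The distortion estimate needed is d |g''/g'| <= 4.61 at the centre of a disc of
radius d where g is holomorphic (preschwarz_bound; the sharp constant is 4). It
follows from the Schwarzian estimate d^2 |S_g| <= 6 (schwarz_bound) by a maximum
principle: let Y = g''/g' and let e be the distance to the boundary. At a point
where e |Y| is maximal, e |Y'| <= |Y| (slope_at_weighted_max), and
Y' = Y^2/2 + S_g, so that m = e |Y| satisfies m^2 <= 2 m + 12.

The Schwarzian estimate is classically deduced from the area theorem. Here it
comes from the positivity of logarithmic energy (log_energy): if real charges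
mu_j of total mass zero sit at points x_j, then the sum of
mu_j mu_k ln (eps + |x_j - x_k|^2) is at most 0. Take for x_j the images under g
of N equidistant points w_j of a circle, and for mu_j a cosine. Then
x_j - x_k = (w_j - w_k) / P(x_j, x_k), where P(x, y) = (f(x) - f(y)) / (x - y)
vanishes nowhere on the image of g. The factor w_j - w_k contributes the energy of
the circle (circle_energy_ge), tending to -1/2 after division by N^2. The
factor P contributes circular means of the function ln |P|, harmonic in each
variable; they isolate its second mixed derivative at the centre, which is
-S_g / 6 (charge_energy_diffquot). Letting N tend to infinity gives the bound.

Complex integration is replaced by means over N-th roots of unity. The mean value
property holds for them up to O(1/N) (discrete_mean_value), with constants that
are uniform because all functions that occur are rational in g and have bounded
derivatives of all orders in a smaller disc (the families called tame below). *)

(** * The modulus with real values *)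

Section Modulus.
Variable R : realType.
Implicit Types z w u : R[i].

(** The norm of R[i] has values in R[i]; real estimates use its real part. *)
Definition cmod z : R := complex.Re `|z|.

Lemma cmodE z : `|z| = (cmod z)%:C.
Proof. by rewrite /cmod normc_def. Qed.

Lemma cmod_ge0 z : 0 <= cmod z.
Proof. by have := normr_ge0 z; rewrite cmodE lecR. Qed.

Lemma cmodM z w : cmod (z * w) = cmod z * cmod w.
Proof. by apply: complexI; rewrite -cmodE normrM !cmodE rmorphM. Qed.

Lemma cmodD z w : cmod (z + w) <= cmod z + cmod w.
Proof. by rewrite -lecR rmorphD /= -!cmodE ler_normD. Qed.

Lemma cmodN z : cmod (- z) = cmod z.
Proof. by rewrite /cmod normrN. Qed.

Lemma cmodC z w : cmod (z - w) = cmod (w - z).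
Proof. by rewrite /cmod distrC. Qed.

Lemma cmod0 : cmod 0 = 0. Proof. by rewrite /cmod normr0. Qed.

Lemma cmod1 : cmod 1 = 1. Proof. by rewrite /cmod normr1. Qed.

Lemma cmodV z : cmod z^-1 = (cmod z)^-1.
Proof. by apply: complexI; rewrite fmorphV /= -!cmodE normfV. Qed.

Lemma cmodX z n : cmod (z ^+ n) = cmod z ^+ n.
Proof. by apply: complexI; rewrite rmorphXn /= -!cmodE normrX. Qed.

Lemma cmod_eq0 z : (cmod z == 0) = (z == 0).
Proof. by rewrite -[z == 0]normr_eq0 cmodE -(inj_eq (@complexI R)). Qed.

Lemma cmod_gt0 z : (0 < cmod z) = (z != 0).
Proof. by rewrite -cmod_eq0 lt_def cmod_ge0 andbT. Qed.

Lemma cmod_tri z w u : cmod (z - w) <= cmod (z - u) + cmod (u - w).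
Proof. by have := cmodD (z - u) (u - w); rewrite addrA subrK. Qed.

Lemma cmod_ge z w : cmod z - cmod w <= cmod (z + w).
Proof. by have := cmodD (z + w) (- w); rewrite addrK cmodN; lra. Qed.

Lemma cmodR (x : R) : cmod x%:C = `|x|.
Proof. by rewrite /cmod normc_def /= expr0n /= addr0 sqrtr_sqr. Qed.

Lemma cmod_nat n : cmod n%:R = n%:R.
Proof. by rewrite -[n%:R](@rmorph_nat _ _ (real_complex R)) cmodR ger0_norm. Qed.

Lemma cmodJ z : cmod z^* = cmod z.
Proof. by rewrite /cmod normcJ. Qed.

Lemma cmod_sqr z : cmod z ^+ 2 = complex.Re z ^+ 2 + complex.Im z ^+ 2.
Proof. by apply: complexI; rewrite rmorphXn /= -cmodE -add_Re2_Im2. Qed.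

Lemma mul_conj z : z * z^* = (cmod z ^+ 2)%:C.
Proof. by rewrite rmorphXn /= -cmodE sqr_normc. Qed.

Lemma Re_le_cmod z : complex.Re z <= cmod z.
Proof.
apply: le_trans (ler_norm _) _.
by have := normc_ge_Re z; rewrite cmodE lecR.
Qed.

Lemma ReD z w : complex.Re (z + w) = complex.Re z + complex.Re w.
Proof. by case: z w => [a b] [c d]. Qed.

Lemma ReN z : complex.Re (- z) = - complex.Re z.
Proof. by case: z. Qed.

Lemma ReB z w : complex.Re (z - w) = complex.Re z - complex.Re w.
Proof. by rewrite ReD ReN. Qed.

Lemma ReM z w :
  complex.Re (z * w) = complex.Re z * complex.Re w - complex.Im z * complex.Im w.
Proof. by case: z w => [a b] [c d]. Qed.

Lemma ReZ (x : R) z : complex.Re (x%:C * z) = x * complex.Re z.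
Proof. by rewrite ReM /= mul0r subr0. Qed.

Lemma Re_sum (I : Type) (r : seq I) (P : pred I) (F : I -> R[i]) :
  complex.Re (\sum_(i <- r | P i) F i) = \sum_(i <- r | P i) complex.Re (F i).
Proof. by elim/big_rec2: _ => // i y1 y2 _ <-; rewrite ReD. Qed.

Lemma cmod_sum (I : Type) (r : seq I) (P : pred I) (F : I -> R[i]) :
  cmod (\sum_(i <- r | P i) F i) <= \sum_(i <- r | P i) cmod (F i).
Proof.
elim/big_rec2: _ => [|i y1 y2 _ h]; first by rewrite cmod0.
by apply: le_trans (cmodD _ _) _; rewrite lerD2l.
Qed.

Lemma unit_align z : exists2 u, cmod u = 1 & u * z = (cmod z)%:C.
Proof.
have [->|z0] := eqVneq z 0; first by exists 1; rewrite ?cmod1 // mulr0 cmod0.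
have m0 : cmod z != 0 by rewrite cmod_eq0.
exists (z^* / (cmod z)%:C).
  by rewrite cmodM cmodV cmodR cmodJ ger0_norm ?cmod_ge0 // divff.
rewrite mulrAC [z^* * z]mulrC mul_conj expr2 rmorphM mulfK //.
by rewrite -(rmorph0 (real_complex R)) (inj_eq (@complexI R)).
Qed.

Lemma cplx_is_real_path (a b : R[i]) (s t : R) :
  (a + s%:C * b) - (a + t%:C * b) = (s - t)%:C * b.
Proof. by rewrite rmorphB /= mulrBl opprD addrACA subrr add0r. Qed.

End Modulus.

(** * Derivatives and comparison along a ray *)

Section ComplexDerivative.
Variable R : realType.
Implicit Types (z w u d : R[i]) (phi psi : R[i] -> R[i]).

Definition cderiv phi w d : Prop :=
  is_derive (w : R[i]^o) (1 : R[i]^o) (phi : R[i]^o -> R[i]^o) (d : R[i]^o).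

Definition ccont phi w : Prop :=
  forall e : R, 0 < e -> exists2 dl : R, 0 < dl &
    forall u, cmod (u - w) < dl -> cmod (phi u - phi w) < e.

Lemma cderiv_approx phi w d : cderiv phi w d ->
  forall e : R, 0 < e -> exists2 dl : R, 0 < dl &
    forall u, cmod (u - w) < dl ->
      cmod (phi u - phi w - d * (u - w)) <= e * cmod (u - w).
Proof.
case=> dphi vphi e e0.
have /cvgrPdist_lt/(_ e%:C) : (fun h : R[i]^o => h^-1 *:
    ((phi : R[i]^o -> R[i]^o) (h *: (1 : R[i]^o) + w) - phi w)) @ 0^' --> (d : R[i]^o).
  by rewrite -vphi; exact: dphi.
rewrite ltcR => /(_ e0) [dl /= dl0 H].
have dlE : dl = (complex.Re dl)%:C.
  by rewrite RRe_real // gtr0_real.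
exists (complex.Re dl); first by move: dl0; rewrite dlE ltcR.
move=> u hu; have [->|uw] := eqVneq u w; first by rewrite !subrr mulr0 subr0 cmod0 mulr0.
have uw0 : u - w != 0 by rewrite subr_eq0.
have := H (u - w); rewrite /= sub0r normrN cmodE dlE ltcR => /(_ hu uw0).
rewrite cmodE ltcR [(u - w) *: _]mulr1 subrK -[_ *: _]/((u-w)^-1 * (phi u - phi w)) => lt1.
apply: ltW; rewrite -ltr_pdivrMr ?cmod_gt0 // -cmodV -cmodM.
by rewrite mulrBl mulfK // cmodC [_ / _]mulrC.
Qed.

End ComplexDerivative.

Section RealDerivative.
Variable R : realType.

Lemma is_derive_approx (f : R -> R) (t d : R) :
  (forall e : R, 0 < e -> exists2 dl : R, 0 < dl &
    forall s, `|s - t| < dl -> `|f s - f t - d * (s - t)| <= e * `|s - t|) ->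
  is_derive t 1 f d.
Proof.
move=> H.
have cv : (fun h : R => h^-1 *: (f (h *: (1 : R) + t) - f t)) @ 0^' --> d.
  apply/cvgrPdist_le => e e0; have [dl dl0 {}H] := H _ e0.
  exists dl => // h /=; rewrite sub0r normrN => hdl h0.
  have := H (h + t); rewrite addrK => /(_ hdl).
  rewrite [_%:A]mulr1 -[_ *: _]/(_ * _) distrC => le1.
  rewrite -(ler_pM2r (_ : 0 < `|h|)) ?normr_gt0 //; apply: le_trans le1.
  by rewrite -normrM mulrBl mulrAC mulVf // mul1r.
by split; [apply/cvg_ex; exists d | apply: cvg_lim cv].
Qed.

Lemma is_derive_continuous (f : R -> R) (t d : R) :
  is_derive t 1 f d -> {for t, continuous f}.
Proof. by case=> df _; apply/differentiable_continuous/derivable1_diffP. Qed.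

Lemma rderivE (f : R -> R) (t d d' : R) : is_derive t 1 f d -> d = d' ->
  is_derive t 1 f d'.
Proof. by move=> h <-. Qed.

Lemma rderivD (f g : R -> R) (t d d' : R) : is_derive t 1 f d -> is_derive t 1 g d' ->
  is_derive t 1 (fun x => f x + g x) (d + d').
Proof. by move=> h h'; exact: is_deriveD. Qed.

Lemma rderivB (f g : R -> R) (t d d' : R) : is_derive t 1 f d -> is_derive t 1 g d' ->
  is_derive t 1 (fun x => f x - g x) (d - d').
Proof. by move=> h h'; exact: is_deriveB. Qed.

Lemma rderivM (f g : R -> R) (t d d' : R) : is_derive t 1 f d -> is_derive t 1 g d' ->
  is_derive t 1 (fun x => f x * g x) (d * g t + f t * d').
Proof.
move=> h h'; apply: rderivE (@is_deriveM R _ f g t 1 d d' h h') _.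
by rewrite -![_ *: _]/(_ * _) addrC [g t * _]mulrC.
Qed.

Lemma rderivZ (f : R -> R) (c t d : R) : is_derive t 1 f d ->
  is_derive t 1 (fun x => c * f x) (c * d).
Proof. by move=> h; exact: is_deriveZ. Qed.

Lemma rderiv_id (t : R) : is_derive t 1 (fun x : R => x) 1.
Proof. exact: is_derive_id. Qed.

Lemma rderiv_cst (c t : R) : is_derive t 1 (fun=> c) 0.
Proof. exact: is_derive_cst. Qed.

Lemma rderivN (f : R -> R) (t d : R) : is_derive t 1 f d ->
  is_derive t 1 (fun x => - f x) (- d).
Proof. by move=> h; exact: is_deriveN. Qed.

Lemma rderiv_lin (c t : R) : is_derive t 1 (fun x => c * x) c.
Proof. by apply: rderivE (rderivZ c (rderiv_id t)) (mulr1 _). Qed.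

Lemma rderivX (f : R -> R) n (t d : R) : is_derive t 1 f d ->
  is_derive t 1 (fun x => f x ^+ n) (n%:R * f t ^+ n.-1 * d).
Proof.
move=> h; elim: n => [|n IH].
  by rewrite !mul0r; have -> : (fun x => f x ^+ 0) = fun=> 1 :> R by []; exact: rderiv_cst.
have -> : (fun x => f x ^+ n.+1) = fun x => f x * f x ^+ n.
  by apply/funext => x; rewrite exprS.
apply: rderivE (rderivM h IH) _ => /=.
by case: n {IH} => [|n] /=; rewrite ?expr0 ?mul0r ?mulr0 ?addr0 ?mulr1 ?mul1r // -natr1 exprS; ring.
Qed.

Lemma rderiv_sum (I : Type) (r : seq I) (f : I -> R -> R) (t : R) (d : I -> R) :
  (forall j, is_derive t 1 (f j) (d j)) ->
  is_derive t 1 (fun x => \sum_(j <- r) f j x) (\sum_(j <- r) d j).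
Proof.
move=> h; elim: r => [|j r IH].
  rewrite big_nil; have -> : (fun x => \sum_(j <- [::]) f j x) = fun=> 0.
    by apply/funext => x; rewrite big_nil.
  exact: rderiv_cst.
rewrite big_cons; have -> : (fun x => \sum_(k <- j :: r) f k x) =
  fun x => f j x + \sum_(k <- r) f k x by apply/funext => x; rewrite big_cons.
exact: rderivD.
Qed.

Lemma rderiv_ln (f : R -> R) (t d : R) : 0 < f t -> is_derive t 1 f d ->
  is_derive t 1 (fun x => ln (f x)) (d / f t).
Proof.
move=> f0 h; rewrite mulrC.
exact: (@is_derive1_comp _ (@ln R) f _ _ _ (is_derive1_ln f0) h).
Qed.

Lemma le_of_derive_le0 (f df : R -> R) (T : R) : 0 <= T ->
  (forall t, 0 <= t <= T -> is_derive t 1 f (df t)) ->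
  (forall t, 0 <= t <= T -> df t <= 0) -> f T <= f 0.
Proof.
move=> T0 fd dle.
have [|||c + Hc] := @MVT_segment R f df 0 T => //.
- move=> x; rewrite in_itv /= => /andP[x0 xT]; apply: fd.
  by rewrite (ltW x0) (ltW xT).
- apply: continuous_in_subspaceT => x; rewrite inE /= in_itv /= => xI.
  exact: is_derive_continuous (fd _ xI).
rewrite in_itv /= => cI.
rewrite -subr_le0 Hc subr0; exact: mulr_le0_ge0 (dle _ cI) T0.
Qed.

Lemma dist_le_of_derive_le (f df : R -> R) (T k m : R) : 0 <= T ->
  (forall t, 0 <= t <= T -> is_derive t 1 f (df t)) ->
  (forall t, 0 <= t <= T -> `|df t - k| <= m) ->
  `|f T - f 0 - k * T| <= m * T.
Proof.
move=> T0 fd dle.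
have H (s : R) : `|s| = 1 -> s * (f T - f 0 - k * T) <= m * T.
  move=> s1.
  have := @le_of_derive_le0 (fun t => s * (f t - k * t) - m * t)
    (fun t => s * (df t - k) - m) T T0.
  rewrite !mulr0 !subr0 => {}H.
  suff : s * (f T - k * T) - m * T <= s * f 0 by lra.
  apply: H => t tI.
    have fdt := fd t tI.
    exact: rderivB (rderivZ s (rderivB fdt (rderiv_lin k t))) (rderiv_lin m t).
  rewrite subr_le0 (le_trans (ler_norm _)) // normrM s1 mul1r; exact: dle.
rewrite ler_norml -[- _ <= _]lerN2 opprK -[- (_ - _)]mulN1r -[X in _ && (X <= _)]mul1r.
by rewrite !H ?normrN ?normr1.
Qed.

End RealDerivative.

Section DerivativeRules.
Variable R : realType.
Implicit Types (z w u d : R[i]) (phi psi : R[i] -> R[i]).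

Lemma cderivE phi w d d' : cderiv phi w d -> d = d' -> cderiv phi w d'.
Proof. by move=> h <-. Qed.

Lemma cderiv_uniq phi w d d' : cderiv phi w d -> cderiv phi w d' -> d = d'.
Proof. by case=> _ <- [_ <-]. Qed.

Lemma cderiv_cst (c : R[i]) w : cderiv (fun=> c) w 0.
Proof. exact: is_derive_cst. Qed.

Lemma cderiv_id w : cderiv id w 1.
Proof. exact: is_derive_id. Qed.

Lemma cderivD phi psi w d d' : cderiv phi w d -> cderiv psi w d' ->
  cderiv (fun z => phi z + psi z) w (d + d').
Proof. by move=> h h'; exact: is_deriveD. Qed.

Lemma cderivN phi w d : cderiv phi w d -> cderiv (fun z => - phi z) w (- d).
Proof. by move=> h; exact: is_deriveN. Qed.

Lemma cderivB phi psi w d d' : cderiv phi w d -> cderiv psi w d' ->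
  cderiv (fun z => phi z - psi z) w (d - d').
Proof. by move=> h h'; apply: cderivD => //; apply: cderivN. Qed.

Lemma cderivM phi psi w d d' : cderiv phi w d -> cderiv psi w d' ->
  cderiv (fun z => phi z * psi z) w (d * psi w + phi w * d').
Proof.
move=> h h'.
have H : cderiv (fun z => phi z * psi z) w (phi w * d' + psi w * d).
  exact: (@is_deriveM R[i] R[i]^o phi psi w 1 d d' h h').
by apply: cderivE H _; rewrite addrC [psi w * _]mulrC.
Qed.

Lemma cderivV phi w d : phi w != 0 -> cderiv phi w d ->
  cderiv (fun z => (phi z)^-1) w (- d / phi w ^+ 2).
Proof.
move=> n0 [df vf]; split; first exact: (@derivableV R[i] R[i]^o phi).
rewrite (@deriveV R[i] R[i]^o phi) // vf -![_ *: _]/(_ * _).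
by rewrite mulNr mulrC mulNr mulrC.
Qed.

Lemma cderiv_sum (I : Type) (r : seq I) (phi : I -> R[i] -> R[i]) w (d : I -> R[i]) :
  (forall j, cderiv (phi j) w (d j)) ->
  cderiv (fun z => \sum_(j <- r) phi j z) w (\sum_(j <- r) d j).
Proof.
move=> h; elim: r => [|j r IH].
  rewrite big_nil; have -> : (fun z => \sum_(j <- [::]) phi j z) = fun=> 0.
    by apply/funext => x; rewrite big_nil.
  exact: cderiv_cst.
rewrite big_cons; have -> : (fun z => \sum_(k <- j :: r) phi k z) =
  fun x => phi j x + \sum_(k <- r) phi k x by apply/funext => x; rewrite big_cons.
exact: cderivD.
Qed.

Lemma cderiv_horner (p : {poly R[i]}) w : cderiv (horner p) w p^`().[w].
Proof.
elim/poly_ind: p => [|p c IH].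
  rewrite deriv0 horner0; have -> : horner (0 : {poly R[i]}) = fun=> 0.
    by apply/funext => z; rewrite horner0.
  exact: cderiv_cst.
have -> : horner (p * 'X + c%:P) = fun z => p.[z] * z + c.
  by apply/funext => z; rewrite hornerMXaddC.
apply: cderivE (cderivD (cderivM IH (cderiv_id w)) (cderiv_cst c w)) _.
by rewrite derivD derivC derivM derivX !hornerE.
Qed.

Lemma cderiv_ccont phi w d : cderiv phi w d -> ccont phi w.
Proof.
move=> h e e0; have [dl dl0 H] := cderiv_approx h ltr01.
have k0 : 0 < 1 + cmod d by rewrite ltr_wpDr ?cmod_ge0.
exists (Num.min dl (e / (1 + cmod d))); first by rewrite lt_min dl0 divr_gt0.
move=> u; rewrite lt_min => /andP[/H h1 h2].
rewrite ltr_pdivlMr // in h2; apply: le_lt_trans h2.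
have -> : phi u - phi w = (phi u - phi w - d * (u - w)) + d * (u - w).
  by rewrite subrK.
apply: le_trans (cmodD _ _) _; rewrite [_ * (1 + _)]mulrDr mulr1 [cmod (d * _)]cmodM [cmod d * _]mulrC.
by rewrite lerD2r (le_trans h1) // mul1r.
Qed.

Lemma cderiv_of_approx phi w d :
  (forall e : R, 0 < e -> exists2 dl : R, 0 < dl &
    forall u, cmod (u - w) < dl ->
      cmod (phi u - phi w - d * (u - w)) <= e * cmod (u - w)) ->
  cderiv phi w d.
Proof.
move=> H.
have cv : (fun h : R[i]^o => h^-1 *:
    ((phi : R[i]^o -> R[i]^o) (h *: (1 : R[i]^o) + w) - phi w)) @ 0^' --> (d : R[i]^o).
  apply/cvgrPdist_le => e e0.
  have eE : e = (complex.Re e)%:C by rewrite RRe_real // gtr0_real.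
  have e0' : 0 < complex.Re e by move: e0; rewrite eE ltcR.
  have [dl dl0 {}H] := H _ e0'.
  exists dl%:C; first by rewrite /= ltcR.
  move=> h /=; rewrite sub0r normrN cmodE ltcR => hdl h0.
  have := H (h + w); rewrite addrK => /(_ hdl).
  rewrite -[h *: _]/(h * 1) mulr1 -[_ *: _]/(_ * _) cmodE eE lecR cmodC => le1.
  rewrite -(ler_pM2r (_ : 0 < cmod h)) ?cmod_gt0 //; apply: le_trans le1.
  by rewrite -cmodM mulrBl mulrAC mulVf // mul1r cmodC.
by split; [apply/cvg_ex; exists d | apply: cvg_lim cv].
Qed.

Lemma cderiv_comp phi psi w d d' : cderiv psi w d -> cderiv phi (psi w) d' ->
  cderiv (fun z => phi (psi z)) w (d' * d).
Proof.
move=> h h'; apply: cderiv_of_approx => e e0.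
have k0 : 0 < 1 + cmod d by rewrite ltr_wpDr ?cmod_ge0.
have k1 : 0 < 1 + cmod d' by rewrite ltr_wpDr ?cmod_ge0.
have e2 : 0 < e / 2 by rewrite divr_gt0.
have [d1 d10 H1] := cderiv_approx h' (divr_gt0 e2 k0).
have [d2 d20 H2] := cderiv_approx h (divr_gt0 e2 k1).
have [d3 d30 H3] := cderiv_approx h ltr01.
have [d4 d40 H4] := cderiv_ccont h d10.
exists (Num.min (Num.min d2 d3) d4); first by rewrite !lt_min d20 d30.
move=> u; rewrite !lt_min => /andP[/andP[/H2 h2 /H3 h3] /H4 /H1 h1].
have -> : phi (psi u) - phi (psi w) - d' * d * (u - w) =
  (phi (psi u) - phi (psi w) - d' * (psi u - psi w))
  + d' * (psi u - psi w - d * (u - w)) by ring.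
apply: le_trans (cmodD _ _) _; rewrite [cmod (d' * _)]cmodM.
have m0 := cmod_ge0 (u - w).
have h5 : cmod (psi u - psi w) <= (1 + cmod d) * cmod (u - w).
  have -> : psi u - psi w = (psi u - psi w - d * (u - w)) + d * (u - w) by ring.
  apply: le_trans (cmodD _ _) _; rewrite [cmod (d * _)]cmodM mulrDl.
  by rewrite lerD2r.
have h6 : e / 2 / (1 + cmod d) * cmod (psi u - psi w) <= e / 2 * cmod (u - w).
  rewrite -mulrA ler_pM2l // mulrC ler_pdivrMr // mulrC; exact: h5.
have h7 : cmod d' * cmod (psi u - psi w - d * (u - w)) <= e / 2 * cmod (u - w).
  apply: le_trans (_ : (1 + cmod d') * (e / 2 / (1 + cmod d') * cmod (u - w)) <= _).
    apply: ler_pM => //; rewrite ?cmod_ge0 // lerDr //.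
  by rewrite mulrA [(1 + _) * _]mulrC divfK // gt_eqF.
lra.
Qed.

Lemma derive_Re_path phi (a b d : R[i]) (t : R) :
  cderiv phi (a + t%:C * b) d ->
  is_derive t 1 (fun s : R => complex.Re (phi (a + s%:C * b)))
    (complex.Re (d * b)).
Proof.
move=> h; apply: is_derive_approx => e e0.
have b0 : 0 < 1 + cmod b by rewrite ltr_wpDr ?cmod_ge0.
have [dl dl0 H] := cderiv_approx h (divr_gt0 e0 b0).
exists (dl / (1 + cmod b)); first exact: divr_gt0.
move=> s; rewrite ltr_pdivlMr // => hs.
have := H (a + s%:C * b); rewrite cplx_is_real_path cmodM cmodR.
have le1 : `|s - t| * cmod b <= `|s - t| * (1 + cmod b).
  by rewrite ler_wpM2l // lerDr.
move=> /(_ (le_lt_trans le1 hs)) h1.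
have -> : complex.Re (phi (a + s%:C * b)) - complex.Re (phi (a + t%:C * b))
    - complex.Re (d * b) * (s - t) =
  complex.Re (phi (a + s%:C * b) - phi (a + t%:C * b) - d * ((s - t)%:C * b)).
  by rewrite !ReB mulrCA ReZ [_ * (s - t)]mulrC.
have := normc_ge_Re (phi (a + s%:C * b) - phi (a + t%:C * b) - d * ((s - t)%:C * b)).
rewrite cmodE lecR => h2; apply: le_trans h2 (le_trans h1 _).
rewrite mulrAC ler_pdivrMr // -mulrA ler_pM2l //.
Qed.

(** Multiplying phi by the unit that turns its total variation onto the positive
axis reduces the statement to the monotonicity of a real function. *)
Lemma path_variation phi (dphi : R -> R[i]) (B dB : R -> R) (a b : R[i]) (T : R) :
  0 <= T ->
  (forall t, 0 <= t <= T -> cderiv phi (a + t%:C * b) (dphi t)) ->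
  (forall t, 0 <= t <= T -> is_derive t 1 B (dB t)) ->
  (forall t, 0 <= t <= T -> cmod (dphi t * b) <= dB t) ->
  cmod (phi (a + T%:C * b) - phi a) <= B T - B 0.
Proof.
move=> T0 dp dBB le1.
have [u u1 hu] := unit_align (phi (a + T%:C * b) - phi a).
pose f t : R := complex.Re (u * phi (a + t%:C * b)) - B t.
have : f T <= f 0.
  apply: (@le_of_derive_le0 _ f (fun t => complex.Re (u * dphi t * b) - dB t)) => // t tI.
    have dBt := dBB _ tI.
    have := @derive_Re_path (fun z => u * phi z) a b (u * dphi t) t.
    have h : cderiv (fun z => u * phi z) (a + t%:C * b) (u * dphi t).
      apply: cderivE (cderivM (cderiv_cst u _) (dp _ tI)) _.
      by rewrite mul0r add0r.
    by move=> /(_ h) h1; exact: is_deriveB.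
  rewrite subr_le0; apply: le_trans (Re_le_cmod _) _.
  by rewrite -mulrA cmodM u1 mul1r; exact: le1.
rewrite /f rmorph0 mul0r addr0.
have : complex.Re (u * (phi (a + T%:C * b) - phi a)) =
  cmod (phi (a + T%:C * b) - phi a) by rewrite hu.
by rewrite mulrBr ReB; lra.
Qed.

Definition cball (a : R[i]) (r : R) z := cmod (z - a) < r.

Lemma segment_in_cball (a w z : R[i]) r t : 0 <= t <= 1 ->
  cball a r w -> cball a r z -> cball a r (w + t%:C * (z - w)).
Proof.
move=> /andP[t0 t1]; rewrite /cball => hw hz.
have -> : w + t%:C * (z - w) - a = (1 - t)%:C * (w - a) + t%:C * (z - a).
  by rewrite rmorphB /= rmorph1; ring.
apply: le_lt_trans (cmodD _ _) _; rewrite !cmodM !cmodR.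
rewrite (ger0_norm t0) ger0_norm ?subr_ge0 //.
have [->|tn1] := eqVneq t 1; first by rewrite subrr mul0r add0r mul1r.
have : (1 - t) * cmod (w - a) < (1 - t) * r.
  by rewrite ltr_pM2l // subr_gt0 lt_neqAle tn1.
have : t * cmod (z - a) <= t * r by rewrite ler_wpM2l // ltW.
lra.
Qed.

Lemma mean_value_ineq phi dphi (a w z : R[i]) (r c : R) :
  (forall u, cball a r u -> cderiv phi u (dphi u)) ->
  (forall u, cball a r u -> cmod (dphi u) <= c) ->
  cball a r w -> cball a r z ->
  cmod (phi z - phi w) <= c * cmod (z - w).
Proof.
move=> dp bd hw hz.
have := @path_variation phi (fun t => dphi (w + t%:C * (z - w)))
  (fun t => (c * cmod (z - w)) * t) (fun=> c * cmod (z - w)) w (z - w) 1 ler01.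
rewrite mulr1 mulr0 subr0 rmorph1 mul1r [w + _]addrC subrK; apply.
- by move=> t tI; apply/dp/segment_in_cball.
- by move=> t _; exact: rderiv_lin.
by move=> t tI; rewrite cmodM ler_wpM2r ?cmod_ge0 //; apply/bd/segment_in_cball.
Qed.

Lemma taylor_ineq phi dphi ddphi (a w z : R[i]) (r c : R) :
  (forall u, cball a r u -> cderiv phi u (dphi u)) ->
  (forall u, cball a r u -> cderiv dphi u (ddphi u)) ->
  (forall u, cball a r u -> cmod (ddphi u) <= c) ->
  cball a r w -> cball a r z ->
  cmod (phi z - phi w - dphi w * (z - w)) <= c * cmod (z - w) ^+ 2.
Proof.
move=> dp ddp bd hw hz.
have c0 : 0 <= c by apply: le_trans (cmod_ge0 _) (bd _ hw).
have := @path_variation (fun u => phi u - dphi w * (u - w))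
  (fun t => dphi (w + t%:C * (z - w)) - dphi w)
  (fun t => (c * cmod (z - w) ^+ 2) * t) (fun=> c * cmod (z - w) ^+ 2) w (z - w) 1 ler01.
rewrite mulr1 mulr0 subr0 rmorph1 mul1r [w + _]addrC subrK subrr mulr0 subr0.
rewrite [_ - _ - phi w]addrAC; apply.
- move=> t tI; have hI := segment_in_cball tI hw hz.
  apply: cderivE (cderivB (dp _ hI) (cderivM (cderiv_cst _ _)
    (cderivB (cderiv_id _) (cderiv_cst _ _)))) _.
  by rewrite mul0r add0r subr0 mulr1.
- by move=> t _; exact: rderiv_lin.
move=> t tI; have hI := segment_in_cball tI hw hz.
rewrite cmodM expr2 mulrA ler_wpM2r ?cmod_ge0 //.
apply: le_trans (mean_value_ineq ddp bd hw hI) _.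
rewrite addrAC subrr add0r cmodM cmodR ler_wpM2l //.
case/andP: tI => t0 t1.
by rewrite ger0_norm // ler_piMl ?cmod_ge0.
Qed.

End DerivativeRules.

(** * Extreme values on a closed disc *)

Section Compactness.
Variable R : realType.

Definition disc_set (r : R) : set (R * R) := [set p | p.1 ^+ 2 + p.2 ^+ 2 <= r ^+ 2].

Lemma compact_disc_set (r : R) : 0 <= r -> compact (disc_set r).
Proof.
move=> r0; apply: (@subclosed_compact _ _ (`[-r, r] `*` `[-r, r])).
- have -> : disc_set r = (fun p : R * R => p.1 ^+ 2 + p.2 ^+ 2) @^-1` [set x | x <= r ^+ 2].
    by [].
  apply: closed_comp; last exact: closed_le.
  move=> p _; apply: cvgD; rewrite !expr2; apply: cvgM; solve [exact: cvg_fst | exact: cvg_snd].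
- by apply: compact_setX; exact: segment_compact.
move=> [x y]; rewrite /disc_set /= => le1.
have h (s : R) : s ^+ 2 <= r ^+ 2 -> `[-r, r]%classic s.
  rewrite -(real_normK (num_real s)) ler_pXn2r ?nnegrE // ler_norml => /andP[h1 h2].
  by rewrite /= in_itv /= h1 h2.
have x2 := sqr_ge0 x; have y2 := sqr_ge0 y.
by split => /=; apply: h; lra.
Qed.

Definition rcont (Psi : R[i] -> R) (w : R[i]) : Prop :=
  forall e : R, 0 < e -> exists2 dl : R, 0 < dl &
    forall u, cmod (u - w) < dl -> `|Psi u - Psi w| < e.

Lemma disc_max (Psi : R[i] -> R) (a : R[i]) (r : R) : 0 <= r ->
  (forall w, cmod (w - a) <= r -> rcont Psi w) ->
  exists2 m, cmod (m - a) <= r & forall w, cmod (w - a) <= r -> Psi w <= Psi m.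
Proof.
move=> r0 cP.
pose z (p : R * R) : R[i] := a + (p.1 +i* p.2).
have zA p : disc_set r p -> cmod (z p - a) <= r.
  move=> hp; rewrite -(@ler_pXn2r _ 2) ?nnegrE ?cmod_ge0 // cmod_sqr.
  by rewrite /z addrAC subrr add0r.
have [||c cA cmax] := @compact_EVT_max _ R (Psi \o z) (disc_set r) _ (compact_disc_set r0).
- by exists (0, 0); rewrite /disc_set /= !expr0n /= addr0 sqr_ge0.
- apply: continuous_in_subspaceT => p; rewrite inE => pA.
  apply/cvgrPdist_lt => e e0.
  have [dl dl0 H] := cP _ (zA _ pA) _ e0.
  exists ([set x | `|p.1 - x| < dl / 2], [set x | `|p.2 - x| < dl / 2]) => /=.
    have d2 : 0 < dl / 2 by rewrite divr_gt0.
    by split; exists (dl / 2) => //.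
  move=> q /= [h1 h2]; rewrite distrC; apply: H.
  have -> : z q - z p = (q.1 - p.1)%:C + 'i%C * (q.2 - p.2)%:C.
    rewrite /z opprD addrACA subrr add0r; apply/eqP; rewrite eq_complex /=.
    by apply/andP; split; apply/eqP; ring.
  apply: le_lt_trans (cmodD _ _) _; rewrite cmodM !cmodR.
  have -> : cmod ('i%C : R[i]) = 1.
    by apply/eqP; rewrite -(@eqrXn2 _ 2) ?cmod_ge0 // cmod_sqr /= expr0n /= add0r.
  by rewrite mul1r distrC [`|q.2 - _|]distrC; lra.
exists (z c); first by apply: zA; rewrite inE in cA.
move=> w hw.
have := cmax (complex.Re (w - a), complex.Im (w - a)).
rewrite inE /disc_set /= -cmod_sqr ler_pXn2r ?nnegrE ?cmod_ge0 // => /(_ hw).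
by rewrite /z /= -[X in _ + X]/(complex.Re (w - a) +i* complex.Im (w - a)); case: (w - a) (subrK a w) => x y <-; rewrite addrC.
Qed.

Lemma rcont_cmod (phi : R[i] -> R[i]) w : ccont phi w -> rcont (fun u => cmod (phi u)) w.
Proof.
move=> h e e0; have [dl dl0 H] := h e e0; exists dl => // u /H h1.
apply: le_lt_trans h1; rewrite ler_norml.
have := cmod_tri (phi u) 0 (phi w); have := cmod_tri (phi w) 0 (phi u).
rewrite !subr0 [cmod (phi w - _)]cmodC; lra.
Qed.

Lemma rcontM (F G : R[i] -> R) w : rcont F w -> rcont G w -> rcont (fun u => F u * G u) w.
Proof.
move=> hF hG e e0.
have k0 : 0 < `|F w| + `|G w| + 1 by rewrite ltr_wpDl ?addr_ge0.
set k := _ + 1 in k0.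
have [d1 d10 H1] := hF (Num.min 1 (e / k)) (ltac:(rewrite lt_min ltr01 divr_gt0 //)).
have [d2 d20 H2] := hG (e / k) (divr_gt0 e0 k0).
exists (Num.min d1 d2); first by rewrite lt_min d10.
move=> u; rewrite lt_min => /andP[/H1 + /H2 h2]; rewrite lt_min => /andP[h1 h3].
have -> : F u * G u - F w * G w =
  F u * (G u - G w) + (F u - F w) * G w by ring.
apply: le_lt_trans (ler_normD _ _) _; rewrite !normrM.
have hu : `|F u| <= `|F w| + 1.
  have : `|F u| <= `|F u - F w| + `|F w| by rewrite -{1}[F u](subrK (F w)) ler_normD.
  lra.
have : `|F u| * `|G u - G w| <= (`|F w| + 1) * `|G u - G w| by rewrite ler_wpM2r.
have : (`|F w| + 1) * `|G u - G w| < (`|F w| + 1) * (e / k).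
  by rewrite ltr_pM2l // ltr_wpDl.
have : `|F u - F w| * `|G w| <= (e / k) * `|G w| by rewrite ler_wpM2r // ltW.
have : (`|F w| + 1) * (e / k) + (e / k) * `|G w| = e.
  by rewrite [(_ + 1) * _]mulrC -mulrDr -addrA [1 + _]addrC addrA -/k divfK // gt_eqF.
lra.
Qed.

Lemma rcont_gap (a : R[i]) (r : R) w : rcont (fun u => r - cmod (u - a)) w.
Proof.
move=> e e0; exists e => // u hu.
have -> : r - cmod (u - a) - (r - cmod (w - a)) = cmod (w - a) - cmod (u - a) by ring.
apply: le_lt_trans hu; rewrite ler_norml.
have := cmod_tri u a w; have := cmod_tri w a u; rewrite [cmod (w - u)]cmodC; lra.
Qed.

End Compactness.

(** * Holomorphic families with uniformly bounded derivatives *)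

Section TameFamilies.
Variables (R : realType) (a : R[i]) (r : R).
Implicit Types (Phi Psi : R[i] -> R[i] -> R[i]).

Definition bounded_family Phi := exists B : R,
  forall y w, cball a r y -> cball a r w -> cmod (Phi y w) <= B.

(** Phi y w is seen as a family of functions of w indexed by y, both ranging over
the same disc; k derivatives in w exist and are bounded uniformly in y. *)
Fixpoint tame (k : nat) Phi : Prop :=
  bounded_family Phi /\
  if k is l.+1 then exists2 Phi',
    (forall y w, cball a r y -> cball a r w -> cderiv (Phi y) w (Phi' y w)) &
    tame l Phi'
  else True.

Lemma tame_bounded k Phi : tame k Phi -> bounded_family Phi.
Proof. by case: k => [|k] []. Qed.

Lemma tameS k Phi : tame k.+1 Phi -> tame k Phi.
Proof.
elim: k Phi => [|k IH] Phi [b [Phi' h t]]; first by split.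
by split => //; exists Phi' => //; exact: IH.
Qed.

Lemma tame_param k (b : R[i] -> R[i]) :
  (exists B : R, forall y, cball a r y -> cmod (b y) <= B) ->
  tame k (fun y _ => b y).
Proof.
elim: k b => [|k IH] b [B hB]; first by split => //; exists B => y w hy _; exact: hB.
split; first by exists B => y w hy _; exact: hB.
exists (fun _ _ => 0); first by move=> y w _ _; exact: cderiv_cst.
by apply: (IH (fun=> 0)); exists 0 => y _; rewrite cmod0.
Qed.

Lemma tame_cst k (c : R[i]) : tame k (fun _ _ => c).
Proof. by apply: (@tame_param k (fun=> c)); exists (cmod c). Qed.

Lemma tame_id k : tame k (fun _ w => w - a).
Proof.
have b : bounded_family (fun _ w => w - a) by exists r => y w _ /ltW.
case: k => [|k]; first by split.
split => //; exists (fun _ _ => 1); last exact: tame_cst.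
move=> y w _ _; apply: cderivE (cderivB (cderiv_id w) (cderiv_cst a w)) _.
by rewrite subr0.
Qed.

Lemma tameD k Phi Psi : tame k Phi -> tame k Psi ->
  tame k (fun y w => Phi y w + Psi y w).
Proof.
have bD (F G : R[i] -> R[i] -> R[i]) : bounded_family F -> bounded_family G ->
    bounded_family (fun y w => F y w + G y w).
  move=> [B hB] [B' hB']; exists (B + B') => y w hy hw.
  by apply: le_trans (cmodD _ _) (lerD _ _); [exact: hB | exact: hB'].
elim: k Phi Psi => [|k IH] Phi Psi; first by move=> [h _] [h' _]; split => //; exact: bD.
move=> [h [Phi' dP tP]] [h' [Psi' dS tS]]; split; first exact: bD.
exists (fun y w => Phi' y w + Psi' y w); last exact: IH.
by move=> y w hy hw; apply: cderivD; [exact: dP | exact: dS].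
Qed.

Lemma tameM k Phi Psi : tame k Phi -> tame k Psi ->
  tame k (fun y w => Phi y w * Psi y w).
Proof.
have bM (F G : R[i] -> R[i] -> R[i]) : bounded_family F -> bounded_family G ->
    bounded_family (fun y w => F y w * G y w).
  move=> [B hB] [B' hB']; exists (B * B') => y w hy hw.
  by rewrite cmodM ler_pM ?cmod_ge0 ?hB ?hB'.
elim: k Phi Psi => [|k IH] Phi Psi; first by move=> [h _] [h' _]; split => //; exact: bM.
move=> tPhi tPsi; move: (tPhi) (tPsi) => [h [Phi' dP tP]] [h' [Psi' dS tS]].
split; first exact: bM.
exists (fun y w => Phi' y w * Psi y w + Phi y w * Psi' y w).
  by move=> y w hy hw; apply: cderivM; [exact: dP | exact: dS].
by apply: tameD; apply: IH => //; exact: tameS.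
Qed.

Lemma tameN k Phi : tame k Phi -> tame k (fun y w => - Phi y w).
Proof.
move=> h; have := tameM (tame_cst k (-1)) h.
by congr tame; apply/funext => y; apply/funext => w; rewrite mulN1r.
Qed.

Lemma tameX k n Phi : tame k Phi -> tame k (fun y w => Phi y w ^+ n).
Proof.
move=> h; elim: n => [|n IH]; first exact: tame_cst.
have := tameM h IH.
by congr tame; apply/funext => y; apply/funext => w; rewrite exprS.
Qed.

Lemma tame_sum k (I : Type) (s : seq I) (F : I -> R[i] -> R[i] -> R[i]) :
  (forall j, tame k (F j)) -> tame k (fun y w => \sum_(j <- s) F j y w).
Proof.
move=> h; elim: s => [|j s IH].
  have := tame_cst k 0.
  by congr tame; apply/funext => y; apply/funext => w; rewrite big_nil.
have := tameD (h j) IH.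
by congr tame; apply/funext => y; apply/funext => w; rewrite big_cons.
Qed.

Lemma tameV k Phi (m : R) : 0 < m ->
  (forall y w, cball a r y -> cball a r w -> m <= cmod (Phi y w)) ->
  tame k Phi -> tame k (fun y w => (Phi y w)^-1).
Proof.
move=> m0 hm.
have b : bounded_family (fun y w => (Phi y w)^-1).
  exists m^-1 => y w hy hw; have hmw := hm _ _ hy hw; rewrite cmodV.
  by rewrite lef_pV2 // posrE // (lt_le_trans m0).
elim: k => [|k IH] t; first by split.
split => //; case: (t) => _ [Phi' dP tP].
exists (fun y w => - Phi' y w * ((Phi y w)^-1 * (Phi y w)^-1)).
  move=> y w hy hw; have n0 : Phi y w != 0.
    by rewrite -cmod_gt0 (lt_le_trans m0) // hm.
  apply: cderivE (cderivV n0 (dP _ _ hy hw)) _.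
  by rewrite expr2 invfM.
by apply: tameM; [exact: tameN | apply: tameM; apply: IH; exact: tameS].
Qed.

Lemma tame_horner k (p : {poly R[i]}) Phi : tame k Phi ->
  tame k (fun y w => p.[Phi y w]).
Proof.
move=> h; elim/poly_ind: p => [|p c IH].
  have := tame_cst k 0.
  by congr tame; apply/funext => y; apply/funext => w; rewrite horner0.
have := tameD (tameM IH h) (tame_cst k c).
by congr tame; apply/funext => y; apply/funext => w; rewrite hornerMXaddC.
Qed.

(** A solution of the autonomous equation g' = 1/p(g) gains one derivative each
time the equation is used. *)
Lemma tame_inverse k (p : {poly R[i]}) (g : R[i] -> R[i]) (m : R) : 0 < m ->
  (forall w, cball a r w -> cderiv g w p.[g w]^-1) ->
  (forall w, cball a r w -> m <= cmod p.[g w]) ->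
  tame k (fun _ w => g w).
Proof.
move=> m0 dg hm.
have b : bounded_family (fun _ w => g w).
  exists (m^-1 * r + cmod (g a)) => y w _ hw.
  have r0 : 0 < r by apply: le_lt_trans hw; exact: cmod_ge0.
  have ha : cball a r a by rewrite /cball subrr cmod0.
  have bd u : cball a r u -> cmod p.[g u]^-1 <= m^-1.
    move=> hu; have hmu := hm _ hu.
    by rewrite cmodV lef_pV2 // posrE // (lt_le_trans m0).
  have := mean_value_ineq dg bd ha hw.
  have : m^-1 * cmod (w - a) <= m^-1 * r by rewrite ler_pM2l ?invr_gt0 // ltW.
  have := cmodD (g w - g a) (g a); rewrite subrK; lra.
elim: k => [|k IH]; first by split.
split => //; exists (fun _ w => p.[g w]^-1); first by move=> y w _; exact: dg.
apply: (@tameV k (fun _ w => p.[g w]) m) => //; first by move=> y w _; exact: hm.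
exact: (@tame_horner k p (fun _ => g)).
Qed.

End TameFamilies.

(** * Roots of unity and circular means *)

Section RootsOfUnity.
Variable R : realType.
Implicit Types (om z : R[i]) (N : nat).

(** A primitive N-th root of unity next to 1; the constant 8 bounds 2 pi. *)
Definition root_step N om : Prop :=
  [/\ om ^+ N = 1, cmod om = 1, cmod (om - 1) <= 8 / N%:R &
      forall m, (0 < m < N)%N -> om ^+ m != 1].

Lemma cis_expr (x : R) (n : nat) :
  (cos x +i* sin x) ^+ n = cos (x *+ n) +i* sin (x *+ n).
Proof.
elim: n => [|n IH]; first by rewrite expr0 mulr0n cos0 sin0.
rewrite exprS IH mulrS cosD sinD; apply/eqP; rewrite eq_complex /=.
by apply/andP; split; apply/eqP; ring.
Qed.

Lemma cmod_cis (x : R) : cmod (cos x +i* sin x) = 1.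
Proof.
by apply/eqP; rewrite -(@eqrXn2 _ 2) ?cmod_ge0 // cmod_sqr /= cos2Dsin2 expr1n.
Qed.

Lemma sin_le (x : R) : 0 <= x -> sin x <= x.
Proof.
move=> x0; have := @le_of_derive_le0 R (fun t => sin t - t) (fun t => cos t - 1) x x0.
rewrite sin0 subrr subr_le0; apply.
by move=> t _; rewrite subr_le0 cos_le1.
Qed.

(** The chord from 1 to exp(2 i m x) has length 2 |sin (m x)|, with x = pi / N. *)
Lemma root_step_exists N : (0 < N)%N -> exists om, root_step N om.
Proof.
move=> N0; have NR : 0 < N%:R :> R by rewrite ltr0n.
pose x : R := pi / N%:R.
have x0 : 0 < x by rewrite divr_gt0 // pi_gt0.
have xn m : x *+ m = pi * (m%:R / N%:R) by rewrite -[x *+ m]mulr_natr /x -mulrA [_^-1 * _]mulrC.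
have dbl m : cos ((x *+ 2) *+ m) = 1 - 2 * sin (x *+ m) ^+ 2.
  by rewrite -mulrnA mulnC mulrnA cos_mulr2n cos2sin2; ring.
have chord m : cmod ((cos (x *+ 2) +i* sin (x *+ 2)) ^+ m - 1) ^+ 2 = 4 * sin (x *+ m) ^+ 2.
  rewrite cis_expr cmod_sqr /= dbl.
  have := cos2Dsin2 ((x *+ 2) *+ m); rewrite dbl; set s := sin _; set S := sin _ => h.
  by rewrite subr0; lra.
exists (cos (x *+ 2) +i* sin (x *+ 2)); split.
- rewrite cis_expr; have -> : x *+ 2 *+ N = pi *+ 2.
    by rewrite -mulrnA mulnC mulrnA xn divff ?mulr1 // gt_eqF.
  by rewrite cos2pi sin2pi.
- exact: cmod_cis.
- have s0 : `|sin x| <= x.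
    rewrite ler_norml (sin_le (ltW x0)) andbT.
    have := @sin_ge0_pi R x; rewrite (ltW x0) /= => h.
    apply: le_trans (_ : 0 <= _); first by lra.
    by apply: h; rewrite ler_pdivrMr // ler_peMr ?pi_ge0 // ler1n.
  rewrite -(@ler_pXn2r _ 2) ?nnegrE ?cmod_ge0 ?divr_ge0 ?ler0n //.
  have := chord 1%N; rewrite expr1 mulr1n => ->.
  have -> : 4 * sin x ^+ 2 = (2 * `|sin x|) ^+ 2 by rewrite exprMn real_normK ?num_real //; ring.
  rewrite ler_pXn2r ?nnegrE ?mulr_ge0 ?divr_ge0 ?ler0n //.
  apply: le_trans (_ : 2 * x <= _); first by rewrite ler_pM2l.
  rewrite /x mulrA ler_pM2r ?invr_gt0 //.
  by have := @pihalf_lt2 R; lra.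
move=> m /andP[m0 mN]; rewrite -subr_eq0 -cmod_eq0 -sqrf_eq0 chord.
rewrite mulf_neq0 // expf_neq0 // gt_eqF // sin_gt0_pi // xn.
rewrite mulr_gt0 ?divr_gt0 ?pi_gt0 ?ltr0n //=.
by rewrite gtr_pMr ?pi_gt0 // ltr_pdivrMr // mul1r ltr_nat.
Qed.

Lemma geom_root z N : z ^+ N = 1 -> z != 1 -> \sum_(j < N) z ^+ j = 0.
Proof.
move=> zN z1; have := subrX1 z N; rewrite zN subrr => /esym/eqP.
by rewrite mulf_eq0 subr_eq0 (negbTE z1) /= => /eqP.
Qed.

Lemma root_sum N om m : root_step N om -> (0 < m < N)%N ->
  \sum_(j < N) (om ^+ j) ^+ m = 0.
Proof.
move=> [oN _ _ pr] mN.
rewrite (eq_bigr (fun j : 'I_N => (om ^+ m) ^+ j)); last by move=> j _; rewrite exprAC.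
by apply: geom_root (pr _ mN); rewrite exprAC oN expr1n.
Qed.

Lemma root_conj N om j : root_step N om -> (om ^+ j)^* * om ^+ j = 1.
Proof. by move=> [_ h _ _]; rewrite mulrC mul_conj cmodX h !expr1n. Qed.

Lemma conj_sum (I : Type) (s : seq I) (F : I -> R[i]) :
  (\sum_(j <- s) F j)^* = \sum_(j <- s) (F j)^*.
Proof. exact: (raddf_sum (conjc : R[i] -> R[i])). Qed.

Lemma root_sum_conj N om m : root_step N om -> (0 < m < N)%N ->
  \sum_(j < N) ((om ^+ j)^*) ^+ m = 0.
Proof.
move=> h mN; rewrite (eq_bigr (fun j : 'I_N => ((om ^+ j) ^+ m)^*)).
  by rewrite -conj_sum (root_sum h mN); exact: conjc0.
by move=> j _; rewrite [RHS]rmorphXn.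
Qed.

End RootsOfUnity.

Section DiscreteMeans.
Variables (R : realType) (a : R[i]) (r : R).
Implicit Types (om z : R[i]) (N : nat).

Definition mean N (F : 'I_N -> R[i]) : R[i] := N%:R^-1 * \sum_(j < N) F j.

Lemma meanD N (F G : 'I_N -> R[i]) : mean (fun j => F j + G j) = mean F + mean G.
Proof. by rewrite /mean big_split mulrDr. Qed.

Lemma meanZ N c (F : 'I_N -> R[i]) : mean (fun j => c * F j) = c * mean F.
Proof. by rewrite /mean -mulr_sumr mulrCA. Qed.

Lemma mean_cst N c : (0 < N)%N -> mean (fun _ : 'I_N => c) = c.
Proof.
move=> N0; rewrite /mean sumr_const card_ord -[c *+ N]mulr_natl mulrA mulVf ?mul1r //.
by rewrite pnatr_eq0 -lt0n.
Qed.

Lemma on_circle om j (s t : R) : cmod om = 1 -> 0 <= s -> s < t ->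
  cball a t (a + s%:C * om ^+ j).
Proof.
move=> o1 s0 st; rewrite /cball addrAC subrr add0r cmodM cmodX o1 expr1n mulr1.
by rewrite cmodR ger0_norm.
Qed.

(** The circular mean of a holomorphic function is its value at the centre. The
radial derivative of the mean is, up to a factor and second order terms, the sum
of the increments of the function between consecutive points, which telescopes. *)
Lemma discrete_mean_value phi dphi ddphi (c rho : R) N om :
  root_step N om -> (1 < N)%N -> 0 <= rho < r ->
  (forall u, cball a r u -> cderiv phi u (dphi u)) ->
  (forall u, cball a r u -> cderiv dphi u (ddphi u)) ->
  (forall u, cball a r u -> cmod (ddphi u) <= c) ->
  cmod (mean (fun j : 'I_N => phi (a + rho%:C * om ^+ j)) - phi a)
    <= 8 * c * rho ^+ 2 / N%:R.
Proof.
move=> hom N1 /andP[rho0 rhor] dp ddp bd.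
have [oN o1 os pr] := hom.
have N0 : (0 < N)%N by exact: ltn_trans N1.
have NR : 0 < N%:R :> R by rewrite ltr0n.
have r0 : 0 < r by exact: le_lt_trans rhor.
have ha : cball a r a by rewrite /cball subrr cmod0.
have c0 : 0 <= c by exact: le_trans (cmod_ge0 _) (bd _ ha).
have om1 : om - 1 != 0 by rewrite subr_eq0; have := pr 1%N; rewrite expr1; apply.
have inb t j : 0 <= t <= rho -> cball a r (a + t%:C * om ^+ j).
  by move=> /andP[t0 t1]; apply: on_circle => //; exact: le_lt_trans rhor.
have key (t : R) : 0 <= t <= rho ->
    cmod (mean (fun j : 'I_N => dphi (a + t%:C * om ^+ j) * om ^+ j)) <= 8 * c * rho / N%:R.
  move=> tI; have [t0 t1] := andP tI.
  have rhs0 : 0 <= 8 * c * rho / N%:R by rewrite !mulr_ge0 // invr_ge0 ltW.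
  have [->|tn0] := eqVneq t 0.
    rewrite (_ : mean _ = 0) ?cmod0 //.
    rewrite /mean; under eq_bigr do rewrite mul0r addr0.
    rewrite -mulr_sumr; have := root_sum hom (m := 1); rewrite N1 => /(_ isT).
    by under eq_bigr do rewrite expr1; move=> ->; rewrite !mulr0.
  have tp : 0 < t by rewrite lt_neqAle eq_sym tn0.
  have tele : \sum_(j < N) (phi (a + t%:C * om ^+ j.+1) - phi (a + t%:C * om ^+ j)) = 0.
    rewrite -(big_mkord xpredT (fun j => phi (a + t%:C * om ^+ j.+1) - phi (a + t%:C * om ^+ j))).
    by rewrite telescope_sumr // oN expr0 subrr.
  set S := \sum_(j < N) dphi (a + t%:C * om ^+ j) * om ^+ j.
  have le1 : cmod (t%:C * (om - 1) * S) <= N%:R * (c * (t * cmod (om - 1)) ^+ 2).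
    have -> : t%:C * (om - 1) * S = - \sum_(j < N) (phi (a + t%:C * om ^+ j.+1)
        - phi (a + t%:C * om ^+ j)
        - dphi (a + t%:C * om ^+ j) * (t%:C * om ^+ j * (om - 1))).
      rewrite [in RHS]big_split /= tele add0r sumrN opprK /S mulr_sumr.
      by apply: eq_bigr => j _; ring.
    rewrite cmodN; apply: le_trans (cmod_sum _ _ _) _.
    apply: le_trans (_ : \sum_(j < N) c * (t * cmod (om - 1)) ^+ 2 <= _); last first.
      by rewrite sumr_const card_ord -[_ *+ N]mulr_natl.
    apply: ler_sum => j _.
    have := taylor_ineq dp ddp bd (inb t j tI) (inb t j.+1 tI).
    have -> : a + t%:C * om ^+ j.+1 - (a + t%:C * om ^+ j) = t%:C * om ^+ j * (om - 1).
      by rewrite exprS; ring.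
    by rewrite [cmod (_ * _ * (om - 1))]cmodM [cmod (_ * om ^+ j)]cmodM cmodX o1 expr1n mulr1 cmodR (ger0_norm t0).
  have sp : 0 < t * cmod (om - 1) by rewrite mulr_gt0 // cmod_gt0.
  have le2 : cmod S <= N%:R * (c * (t * cmod (om - 1))).
    rewrite -(ler_pM2l sp); apply: le_trans (_ : cmod (t%:C * (om - 1) * S) <= _).
      by rewrite !cmodM cmodR (ger0_norm t0).
    by apply: le_trans le1 _; rewrite le_eqVlt; apply/orP; left; apply/eqP; ring.
  rewrite /mean -/S cmodM cmodV cmod_nat mulrC ler_pdivrMr // divfK ?gt_eqF //.
  apply: le_trans le2 _.
  have -> : N%:R * (c * (t * cmod (om - 1))) = c * t * (cmod (om - 1) * N%:R) by ring.
  have : cmod (om - 1) * N%:R <= 8 by rewrite -ler_pdivlMr.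
  move=> h8; have -> : 8 * c * rho = c * rho * 8 by ring.
  apply: ler_pM => //; rewrite ?mulr_ge0 ?cmod_ge0 ?ler0n //.
  by rewrite ler_wpM2l.
have := @path_variation R (fun s => mean (fun j : 'I_N => phi (a + s * om ^+ j)))
  (fun t => mean (fun j : 'I_N => dphi (a + t%:C * om ^+ j) * om ^+ j))
  (fun t => (8 * c * rho / N%:R) * t) (fun=> 8 * c * rho / N%:R) 0 1 rho rho0.
rewrite mulr1 add0r mulr0 subr0.
have -> : mean (fun j : 'I_N => phi (a + 0 * om ^+ j)) = phi a.
  by rewrite -[RHS](mean_cst _ N0); congr mean; apply/funext => j; rewrite mul0r addr0.
have -> : 8 * c * rho / N%:R * rho = 8 * c * rho ^+ 2 / N%:R by ring.
apply.
- move=> t tI; rewrite mulr1 add0r.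
  apply: cderivE (cderivM (cderiv_cst _ _) (cderiv_sum (index_enum 'I_N)
    (d := fun j => dphi (a + t%:C * om ^+ j) * om ^+ j) _)) _; last by rewrite mul0r add0r.
  move=> j; apply: (@cderiv_comp R phi (fun s => a + s * om ^+ j)); last exact/dp/inb.
  apply: cderivE (cderivD (cderiv_cst _ _) (cderivM (cderiv_id _) (cderiv_cst _ _))) _.
  by rewrite mulr0 addr0 add0r mul1r.
- by move=> t _; exact: rderiv_lin.
by move=> t tI; rewrite mulr1; exact: key.
Qed.

End DiscreteMeans.

(** * Means of holomorphic functions against cosine charges *)

Section TameMeans.
Variables (R : realType) (a : R[i]) (r : R).
Implicit Types (Phi : R[i] -> R[i] -> R[i]) (om : R[i]) (N : nat).

Definition node om (rho : R) (j : nat) : R[i] := a + rho%:C * om ^+ j.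

Lemma tame_mean0 Phi : tame a r 2 Phi -> exists2 C : R, 0 <= C &
  forall N om rho y, root_step N om -> (1 < N)%N -> 0 <= rho < r -> cball a r y ->
    cmod (mean (fun j : 'I_N => Phi y (node om rho j)) - Phi y a) <= C * rho ^+ 2 / N%:R.
Proof.
move=> [_ [Phi1 d1 [_ [Phi2 d2 [[B hB] _]]]]].
exists (8 * `|B|); first by rewrite mulr_ge0.
move=> N om rho y hom N1 rI hy.
apply: (discrete_mean_value (dphi := Phi1 y) (ddphi := Phi2 y) hom N1 rI).
- by move=> u hu; exact: d1.
- by move=> u hu; exact: d2.
- by move=> u hu; exact: le_trans (hB _ _ hy hu) (ler_norm _).
Qed.

Lemma node0 om j : node om 0 j = a.
Proof. by rewrite /node mul0r addr0. Qed.

Lemma mean_root0 N om m : root_step N om -> (0 < m < N)%N -> forall c : R[i],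
  mean (fun j : 'I_N => (om ^+ j) ^+ m * c) = 0.
Proof.
by move=> h mN c; rewrite /mean -mulr_suml (root_sum h mN) mul0r mulr0.
Qed.

(** The mean value property applied to (w - a)^m Phi, which vanishes at a. *)
Lemma tame_mean_pow Phi m : tame a r 2 Phi -> exists2 C : R, 0 <= C &
  forall N om rho y, root_step N om -> (1 < N)%N -> (0 < m < N)%N ->
    0 <= rho < r -> cball a r y ->
    rho ^+ m * cmod (mean (fun j : 'I_N => (om ^+ j) ^+ m * Phi y (node om rho j)))
      <= C * rho ^+ 2 / N%:R.
Proof.
move=> t; have t2 := tameM (tameX m (tame_id a r 2)) t.
have [C C0 H] := tame_mean0 t2; exists C => // N om rho y hom N1 mN rI hy.
have rho0 : 0 <= rho by case/andP: rI.
have := H _ _ _ _ hom N1 rI hy.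
rewrite subrr expr0n; have -> : (m == 0)%N = false by case: m mN {t2 H}.
rewrite mul0r subr0.
have -> : mean (fun j : 'I_N => (node om rho j - a) ^+ m * Phi y (node om rho j)) =
  (rho ^+ m)%:C * mean (fun j : 'I_N => (om ^+ j) ^+ m * Phi y (node om rho j)).
  rewrite -meanZ; congr mean; apply/funext => j.
  by rewrite {1}/node addrAC subrr add0r exprMn -rmorphXn mulrA.
by rewrite cmodM cmodR normrX ger0_norm.
Qed.

Lemma tame_mean1 Phi : tame a r 2 Phi -> exists2 C : R, 0 <= C &
  forall N om rho y, root_step N om -> (1 < N)%N -> 0 <= rho < r -> cball a r y ->
    cmod (mean (fun j : 'I_N => om ^+ j * Phi y (node om rho j))) <= C / N%:R.
Proof.
move=> t; have [C C0 H] := tame_mean_pow 1%N t.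
have [r0|r0] := leP r 0.
  by exists 0 => // N om rho y _ _ /andP[h1 h2]; have := le_lt_trans h1 h2; rewrite ltNge r0.
exists (C * r); first by rewrite mulr_ge0 // ltW.
move=> N om rho y hom N1 rI hy.
have NR : 0 < N%:R :> R by rewrite ltr0n (ltn_trans _ N1).
have [r1 r2] := andP rI.
have [->|rn0] := eqVneq rho 0.
  rewrite (_ : mean _ = 0) ?cmod0 ?divr_ge0 ?mulr_ge0 // ?(ltW r0) // ?(ltW NR) //.
  have := mean_root0 hom (m := 1) N1 (Phi y a).
  by move=> <-; congr mean; apply/funext => j; rewrite node0 expr1.
have rp : 0 < rho by rewrite lt_neqAle eq_sym rn0.
have := H _ _ _ _ hom N1 N1 rI hy; rewrite expr1.
have -> : C * rho ^+ 2 / N%:R = rho * (C * rho / N%:R) by ring.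
rewrite ler_pM2l // => h; apply: le_trans (_ : C * rho / N%:R <= _).
  by apply: le_trans h; rewrite le_eqVlt; apply/orP; left.
by rewrite ler_pM2r ?invr_gt0 // ler_wpM2l // ltW.
Qed.

Lemma tame_mean2 Phi : tame a r 2 Phi -> exists2 C : R, 0 <= C &
  forall N om rho y, root_step N om -> (2 < N)%N -> 0 <= rho < r -> cball a r y ->
    cmod (mean (fun j : 'I_N => (om ^+ j) ^+ 2 * Phi y (node om rho j))) <= C / N%:R.
Proof.
move=> t; have [C C0 H] := tame_mean_pow 2%N t; exists C => //.
move=> N om rho y hom N2 rI hy.
have NR : 0 < N%:R :> R by rewrite ltr0n (ltn_trans _ N2).
have [->|rn0] := eqVneq rho 0.
  rewrite (_ : mean _ = 0) ?cmod0 ?divr_ge0 // ?(ltW NR) //.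
  have := mean_root0 hom (m := 2) N2 (Phi y a).
  by move=> <-; congr mean; apply/funext => j; rewrite node0.
have := H _ _ _ _ hom (ltnW N2) N2 rI hy.
have -> : C * rho ^+ 2 / N%:R = rho ^+ 2 * (C / N%:R) by ring.
by rewrite ler_pM2l // exprn_gt0 // lt_neqAle eq_sym rn0; case/andP: rI.
Qed.

(** The first Taylor coefficient is the circular mean against the conjugate of
the node: its radial derivative is the plain mean of the derivative. *)
Lemma tame_mean_conj Phi Phi1 :
  (forall y w, cball a r y -> cball a r w -> cderiv (Phi y) w (Phi1 y w)) ->
  tame a r 2 Phi1 -> exists2 C : R, 0 <= C &
  forall N om rho y, root_step N om -> (1 < N)%N -> 0 <= rho < r -> cball a r y ->
    cmod (mean (fun j : 'I_N => (om ^+ j)^* * Phi y (node om rho j))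
      - rho%:C * Phi1 y a) <= C / N%:R.
Proof.
move=> dP t; have [C C0 H] := tame_mean0 t.
have [r0|r0] := leP r 0.
  by exists 0 => // N om rho y _ _ /andP[h1 h2]; have := le_lt_trans h1 h2; rewrite ltNge r0.
exists (C * r ^+ 2 * r); first by rewrite mulr_ge0 ?(ltW r0) // mulr_ge0 // sqr_ge0.
move=> N om rho y hom N1 rI hy.
have NR : 0 < N%:R :> R by rewrite ltr0n (ltn_trans _ N1).
have [r1 r2] := andP rI.
have [oN o1 _ _] := hom.
have := @path_variation R
  (fun s => mean (fun j : 'I_N => (om ^+ j)^* * Phi y (a + s * om ^+ j)) - s * Phi1 y a)
  (fun t => mean (fun j : 'I_N => Phi1 y (node om t j)) - Phi1 y a)
  (fun t => (C * r ^+ 2 / N%:R) * t) (fun=> C * r ^+ 2 / N%:R) 0 1 rho r1.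
rewrite mulr1 add0r mulr0 subr0 mul0r subr0.
have -> : mean (fun j : 'I_N => (om ^+ j)^* * Phi y (a + 0 * om ^+ j)) = 0.
  rewrite /mean; under eq_bigr do rewrite mul0r addr0.
  rewrite -mulr_suml; have := root_sum_conj hom (m := 1); rewrite N1 => /(_ isT).
  by under eq_bigr do rewrite expr1; move=> ->; rewrite mul0r mulr0.
rewrite subr0 => h; apply: le_trans (h _ _ _) _.
- move=> s sI; rewrite mulr1 add0r.
  have hs j : cball a r (a + s%:C * om ^+ j).
    by case/andP: sI => s0 s1; apply: on_circle => //; exact: le_lt_trans r2.
  apply: cderivE (cderivB (cderivM (cderiv_cst _ _) (cderiv_sum (index_enum 'I_N)
    (d := fun j => Phi1 y (node om s j)) _)) (cderivM (cderiv_id _) (cderiv_cst _ _))) _.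
    move=> j.
    have dn : cderiv (fun z => a + z * om ^+ j) s%:C (om ^+ j).
      apply: cderivE (cderivD (cderiv_cst _ _) (cderivM (cderiv_id _) (cderiv_cst _ _))) _.
      by rewrite mulr0 addr0 add0r mul1r.
    apply: cderivE (cderivM (cderiv_cst _ _)
      (@cderiv_comp R (Phi y) (fun z => a + z * om ^+ j) _ _ _ dn (dP _ _ hy (hs j)))) _.
    by rewrite mul0r add0r mulrCA (root_conj _ hom) mulr1.
  by rewrite mul0r add0r mul1r mulr0 addr0.
- by move=> s _; exact: rderiv_lin.
- move=> s /andP[s0 s1]; rewrite mulr1.
  have sI : 0 <= s < r by rewrite s0 (le_lt_trans s1).
  apply: le_trans (H _ _ _ _ hom N1 sI hy) _.
  rewrite ler_pM2r ?invr_gt0 // ler_wpM2l // ler_pXn2r ?nnegrE ?(ltW r0) //.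
  by case/andP: sI => _ /ltW.
have -> : C * r ^+ 2 * r / N%:R = (C * r ^+ 2 / N%:R) * r by ring.
by rewrite ler_wpM2l ?(ltW r2) // divr_ge0 ?(ltW NR) // mulr_ge0 // sqr_ge0.
Qed.

(** With c = exp(i s), a cosine of the angle of the j-th node, of phase s. *)
Definition charge (c om : R[i]) (j : nat) : R := complex.Re (c * (om ^+ j)^*).

Lemma charge_le1 c om j : cmod c = 1 -> cmod om = 1 -> `|charge c om j| <= 1.
Proof.
move=> c1 o1; have := normc_ge_Re (c * (om ^+ j)^*).
by rewrite cmodE lecR cmodM cmodJ cmodX c1 o1 expr1n mulr1.
Qed.

Lemma Re2 (z : R[i]) : (complex.Re z)%:C = (z + z^*) / 2.
Proof. exact: ReJ_add. Qed.

Lemma chargeE c om j : (charge c om j)%:C = (c * (om ^+ j)^* + c^* * om ^+ j) / 2.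
Proof. by rewrite Re2 rmorphM /= conjCK. Qed.

Lemma charge_sum0 c N om : root_step N om -> (1 < N)%N ->
  \sum_(j < N) charge c om j = 0.
Proof.
move=> h N1; rewrite -Re_sum -mulr_sumr.
have := root_sum_conj h (m := 1); rewrite N1 => /(_ isT).
by under eq_bigr do rewrite expr1; move=> ->; rewrite mulr0.
Qed.

(** The part of the charge in om^j averages a positive frequency and gives 0; the
part in its conjugate extracts the derivative at the centre. *)
Lemma charge_mean Phi Phi1 :
  (forall y w, cball a r y -> cball a r w -> cderiv (Phi y) w (Phi1 y w)) ->
  tame a r 2 Phi -> tame a r 2 Phi1 -> exists2 C : R, 0 <= C &
  forall N om rho y c, root_step N om -> (1 < N)%N -> 0 <= rho < r -> cball a r y ->
    cmod c = 1 ->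
    cmod (mean (fun j : 'I_N => (charge c om j)%:C * Phi y (node om rho j))
      - c * rho%:C * Phi1 y a / 2) <= C / N%:R.
Proof.
move=> dP t t1.
have [C1 C10 H1] := tame_mean_conj dP t1; have [C2 C20 H2] := tame_mean1 t.
exists (C1 + C2); first exact: addr_ge0.
move=> N om rho y c hom N1 rI hy c1.
have := H1 _ _ _ _ hom N1 rI hy; have := H2 _ _ _ _ hom N1 rI hy.
have -> : mean (fun j : 'I_N => (charge c om j)%:C * Phi y (node om rho j)) =
    c / 2 * mean (fun j : 'I_N => (om ^+ j)^* * Phi y (node om rho j))
    + c^* / 2 * mean (fun j : 'I_N => om ^+ j * Phi y (node om rho j)).
  by rewrite -!meanZ -meanD; congr mean; apply/funext => j; rewrite chargeE; ring.
set E1 := mean _; set E2 := mean _ => h1 h2; clearbody E1 E2.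
have -> : c / 2 * E2 + c^* / 2 * E1 - c * rho%:C * Phi1 y a / 2 =
  c / 2 * (E2 - rho%:C * Phi1 y a) + c^* / 2 * E1 by ring.
apply: le_trans (cmodD _ _) _; rewrite !cmodM cmodJ c1 cmodV cmod_nat !mul1r mulrDl.
have m1 := cmod_ge0 (E2 - rho%:C * Phi1 y a); have m2 := cmod_ge0 E1; lra.
Qed.

Lemma derive_ln_cmod phi (b z d : R[i]) (t : R) :
  cderiv phi (b + t%:C * z) d -> phi (b + t%:C * z) != 0 ->
  is_derive t 1 (fun s : R => ln (cmod (phi (b + s%:C * z)) ^+ 2))
    (2 * complex.Re (d * z / phi (b + t%:C * z))).
Proof.
move=> dp n0.
have d1 := derive_Re_path dp.
have d2 := derive_Re_path (cderivM (cderiv_cst (- 'i%C) _) dp).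
have ImE w : complex.Re (- 'i%C * w) = complex.Im w :> R.
  by case: w => x y /=; ring.
have d3 : is_derive t 1 (fun s : R => complex.Re (phi (b + s%:C * z)) ^+ 2 +
    complex.Re (- 'i%C * phi (b + s%:C * z)) ^+ 2) _ :=
  rderivD (rderivX 2 d1) (rderivX 2 d2).
have eqf : (fun s : R => cmod (phi (b + s%:C * z)) ^+ 2) =
  (fun s : R => complex.Re (phi (b + s%:C * z)) ^+ 2 +
    complex.Re (- 'i%C * phi (b + s%:C * z)) ^+ 2).
  by apply/funext => s; rewrite ImE cmod_sqr.
have pos : 0 < cmod (phi (b + t%:C * z)) ^+ 2 by rewrite exprn_gt0 // cmod_gt0.
move: d3; rewrite -eqf => d3.
apply: rderivE (@rderiv_ln R (fun s : R => cmod (phi (b + s%:C * z)) ^+ 2) t _ pos d3) _.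
rewrite /= mul0r add0r !ImE -[_ * d * z]mulrA ImE.
set p := phi _ in pos n0 *; set q := d * z.
have pc0 : p^* != 0 by rewrite conjC_eq0.
have -> : q / p = ((cmod p ^+ 2)^-1)%:C * (q * p^*).
  by rewrite fmorphV /= -mul_conj; field; rewrite n0 pc0.
rewrite ReZ [complex.Re (q * _)]ReM; clearbody q; clear pc0 n0 pos.
case: (p) (q) => p1 p2 [q1 q2] /=; ring.
Qed.

(** For a zero-free holomorphic p, ln |p|^2 has gradient p'/p, and the mean of
ln |p|^2 against the charges isolates the value of p'/p at the centre. *)
Lemma charge_mean_ln Phi Phi1 (m : R) : 0 < m ->
  (forall y w, cball a r y -> cball a r w -> m <= cmod (Phi y w)) ->
  (forall y w, cball a r y -> cball a r w -> cderiv (Phi y) w (Phi1 y w)) ->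
  tame a r 2 Phi -> tame a r 2 Phi1 -> exists2 C : R, 0 <= C &
  forall N om rho y c, root_step N om -> (2 < N)%N -> 0 <= rho < r -> cball a r y ->
    cmod c = 1 ->
    `|N%:R^-1 * \sum_(j < N) charge c om j * ln (cmod (Phi y (node om rho j)) ^+ 2)
      - rho * complex.Re (c * (Phi1 y a / Phi y a))| <= C / N%:R.
Proof.
move=> m0 hm dP t t1.
have tA := tameM t1 (tameV m0 hm t).
have [C1 C10 H1] := tame_mean0 tA; have [C2 C20 H2] := tame_mean2 tA.
have [r0|r0] := leP r 0.
  by exists 0 => // N om rho y c _ _ /andP[h1 h2]; have := le_lt_trans h1 h2; rewrite ltNge r0.
exists ((C1 * r ^+ 2 + C2) * r).
  by rewrite mulr_ge0 ?(ltW r0) // addr_ge0 // mulr_ge0 // sqr_ge0.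
move=> N om rho y c hom N2 rI hy c1.
have N0 : (0 < N)%N by exact: ltn_trans N2.
have NR : 0 < N%:R :> R by rewrite ltr0n.
have [r1 r2] := andP rI; have [oN o1 _ _] := hom.
have n0 w : cball a r w -> Phi y w != 0.
  by move=> hw; rewrite -cmod_gt0 (lt_le_trans m0) // hm.
set k := complex.Re _.
have := @dist_le_of_derive_le R
  (fun t : R => N%:R^-1 * \sum_(j < N) charge c om j * ln (cmod (Phi y (a + t%:C * om ^+ j)) ^+ 2))
  (fun t => N%:R^-1 * \sum_(j < N) charge c om j *
     (2 * complex.Re (Phi1 y (node om t j) * om ^+ j / Phi y (node om t j))))
  rho k ((C1 * r ^+ 2 + C2) / N%:R) r1.
have -> : N%:R^-1 * (\sum_(j < N) charge c om j *
    ln (cmod (Phi y (a + (0:R)%:C * om ^+ j)) ^+ 2)) = 0.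
  under eq_bigr do rewrite mul0r addr0.
  by rewrite -mulr_suml (charge_sum0 _ hom (ltnW N2)) mul0r mulr0.
rewrite subr0 [k * rho]mulrC => h; apply: le_trans (h _ _) _.
- move=> s /andP[s0 s1]; apply: rderivZ; apply: rderiv_sum => j; apply: rderivZ.
  have hs : cball a r (a + s%:C * om ^+ j) by apply: on_circle => //; exact: le_lt_trans r2.
  by apply: derive_ln_cmod; [exact: dP | exact: n0].
- move=> s /andP[s0 s1].
  have sI : 0 <= s < r by rewrite s0 (le_lt_trans s1).
  have h1 := H1 _ _ _ _ hom (ltnW N2) sI hy; have h2 := H2 _ _ _ _ hom N2 sI hy.
  move: h1 h2; set E0 := mean _; set E2 := mean _ => h1 h2.
  have -> : N%:R^-1 * (\sum_(j < N) charge c om j *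
     (2 * complex.Re (Phi1 y (node om s j) * om ^+ j / Phi y (node om s j)))) =
     complex.Re (c * E0 + c^* * E2).
    rewrite /E0 /E2 -!meanZ -meanD /mean.
    have -> : (N%:R^-1 : R[i]) = (N%:R^-1)%:C by rewrite fmorphV rmorph_nat.
    rewrite ReZ Re_sum; congr (_ * _); apply: eq_bigr => j _.
    have -> : Phi1 y (node om s j) * om ^+ j / Phi y (node om s j) =
      om ^+ j * (Phi1 y (node om s j) / Phi y (node om s j)) by ring.
    set A := Phi1 y (node om s j) / _.
    rewrite mulrCA -ReZ chargeE -[2]/(2%:R) -[X in X * complex.Re _]/(2%:R) -ReZ rmorph_nat.
    congr (complex.Re _); have oj := root_conj j hom.
    have -> : 2 * ((c * (om ^+ j)^* + c^* * om ^+ j) / 2 * (om ^+ j * A)) =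
      c * A * ((om ^+ j)^* * om ^+ j) + c^* * ((om ^+ j) ^+ 2 * A) by field.
    by rewrite oj mulr1.
  clearbody E0 E2.
  have -> : complex.Re (c * E0 + c^* * E2) - k =
    complex.Re (c * (E0 - Phi1 y a / Phi y a) + c^* * E2).
    by rewrite /k -ReB; congr (complex.Re _); ring.
  have := normc_ge_Re (c * (E0 - Phi1 y a / Phi y a) + c^* * E2).
  rewrite cmodE lecR => h3; apply: le_trans h3 _; apply: le_trans (cmodD _ _) _.
  rewrite !cmodM cmodJ c1 !mul1r mulrDl lerD //.
  apply: le_trans h1 _; rewrite ler_pM2r ?invr_gt0 // ler_wpM2l //.
  by rewrite ler_pXn2r ?nnegrE ?(ltW r0) //; case/andP: sI => _ /ltW.
have -> : (C1 * r ^+ 2 + C2) * r / N%:R = (C1 * r ^+ 2 + C2) / N%:R * r by ring.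
by rewrite ler_wpM2l ?(ltW r2) // divr_ge0 ?(ltW NR) // addr_ge0 // mulr_ge0 // sqr_ge0.
Qed.

End TameMeans.

(** * Positivity of logarithmic energy *)

Section LogEnergy.
Variable R : realType.

(** A power of a kernel of finite rank is positive semidefinite: each factor
\sum_l e_l(i) e_l(j) can be absorbed in the weights mu. *)
Lemma pos_def_power (n m p : nat) (e : 'I_m -> 'I_n -> R) (mu : 'I_n -> R) :
  0 <= \sum_(i < n) \sum_(j < n) mu i * mu j * (\sum_(l < m) e l i * e l j) ^+ p.
Proof.
elim: p mu => [|p IH] mu.
  have -> : \sum_(i < n) \sum_(j < n) mu i * mu j * (\sum_(l < m) e l i * e l j) ^+ 0 =
      (\sum_(i < n) mu i) ^+ 2.
    rewrite expr2 mulr_suml; apply: eq_bigr => i _; rewrite mulr_sumr.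
    by apply: eq_bigr => j _; rewrite expr0 mulr1.
  exact: sqr_ge0.
have -> : \sum_(i < n) \sum_(j < n) mu i * mu j * (\sum_(l < m) e l i * e l j) ^+ p.+1 =
  \sum_(l' < m) \sum_(i < n) \sum_(j < n) (mu i * e l' i) * (mu j * e l' j) *
    (\sum_(l < m) e l i * e l j) ^+ p.
  rewrite [RHS]exchange_big; apply: eq_bigr => i _.
  rewrite [RHS]exchange_big; apply: eq_bigr => j _.
  rewrite exprS mulrA mulr_sumr mulr_suml; apply: eq_bigr => l _.
  by ring.
by apply: sumr_ge0 => l _; exact: (IH (fun i => mu i * e l i)).
Qed.

Lemma pos_def_geometric (n m : nat) (e : 'I_m -> 'I_n -> R) (mu : 'I_n -> R) :
  (forall i j, `|\sum_(l < m) e l i * e l j| < 1) ->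
  0 <= \sum_(i < n) \sum_(j < n) mu i * mu j / (1 - \sum_(l < m) e l i * e l j).
Proof.
move=> k1; set k := fun i j => \sum_(l < m) e l i * e l j.
pose u p := \sum_(i < n) \sum_(j < n) mu i * mu j * (1 - k i j ^+ p) / (1 - k i j).
have cu : u @ \oo --> \sum_(i < n) \sum_(j < n) mu i * mu j / (1 - k i j).
  have cs (F : 'I_n -> nat -> R) (L : 'I_n -> R) : (forall i, F i @ \oo --> L i) ->
      (fun p => \sum_(i < n) F i p) @ \oo --> \sum_(i < n) L i.
    move=> h; elim: (index_enum _) => [|i r IH].
      rewrite big_nil; under eq_fun do rewrite big_nil.
      exact: cvg_cst.
    rewrite big_cons; under eq_fun do rewrite big_cons.
    by apply: cvgD.
  apply: (cs (fun i p => \sum_(j < n) mu i * mu j * (1 - k i j ^+ p) / (1 - k i j))) => i.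
  apply: (cs (fun j p => mu i * mu j * (1 - k i j ^+ p) / (1 - k i j))) => j.
  apply: cvgM; last exact: cvg_cst.
  rewrite -[X in _ --> X]mulr1; apply: cvgM; first exact: cvg_cst.
  rewrite -[X in _ --> X]subr0; apply: cvgB; first exact: cvg_cst.
  by apply: cvg_expr; exact: k1.
rewrite -[X in _ <= X](cvg_lim (@Rhausdorff R) cu).
apply: limr_ge; first by apply/cvg_ex; eexists; exact: cu.
near=> p.
have -> : u p = \sum_(q < p) \sum_(i < n) \sum_(j < n) mu i * mu j * k i j ^+ q.
  rewrite exchange_big; apply: eq_bigr => i _.
  rewrite exchange_big; apply: eq_bigr => j _.
  have n0 : 1 - k i j != 0.
    by rewrite subr_eq0 eq_sym lt_eqF // (le_lt_trans (ler_norm _)) // k1.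
  rewrite -mulr_sumr -mulrA; congr (_ * _).
  have := subrX1 (k i j) p; rewrite -(opprB 1 (k i j)) -(opprB 1 (k i j ^+ p)).
  by rewrite mulNr => /oppr_inj ->; rewrite mulrAC divff // mul1r.
by apply: sumr_ge0 => q _; exact: pos_def_power.
Unshelve. all: by end_near. Qed.

(** Positivity of 1/(s + |x - y|^2): after division by p(x) p(y), where
p(x) = sqrt s + |x|^2 / sqrt s, it is a geometric series in a kernel of finite
rank. *)
Lemma pos_def_resolvent (n : nat) (x : 'I_n -> R[i]) (mu : 'I_n -> R) (s : R) :
  0 < s ->
  0 <= \sum_(i < n) \sum_(j < n) mu i * mu j / (s + cmod (x i - x j) ^+ 2).
Proof.
move=> s0; pose c := Num.sqrt s.
have c0 : 0 < c by rewrite sqrtr_gt0.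
have cc : c * c = s by rewrite -expr2 sqr_sqrtr // ltW.
pose q i : R := cmod (x i) ^+ 2.
have q0 i : 0 <= q i by exact: sqr_ge0.
pose p i := c + q i / c.
have p0 i : 0 < p i by rewrite ltr_pwDl // divr_ge0 // ltW.
have pE i : p i = (s + q i) / c by rewrite /p mulrDl -cc mulfK ?gt_eqF.
(* 2 Re x Re y + 2 Im x Im y + |x|^2 |y|^2 / s, as a sum of five products *)
pose e (l : 'I_5) i := nth 0 [:: complex.Re (x i); complex.Re (x i); complex.Im (x i);
   complex.Im (x i); q i / c] l / p i.
have dE i j : cmod (x i - x j) ^+ 2 = q i + q j - 2 * (complex.Re (x i) * complex.Re (x j)
    + complex.Im (x i) * complex.Im (x j)).
  by rewrite /q !cmod_sqr; case: (x i) (x j) => a b [a' b'] /=; ring.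
have kE i j : \sum_(l < 5) e l i * e l j = 1 - (s + cmod (x i - x j) ^+ 2) / (p i * p j).
  rewrite !big_ord_recl big_ord0 /e /= dE !pE -cc.
  have := gt_eqF c0; have := p0 i; have := p0 j; rewrite !pE -cc.
  rewrite !pmulr_lgt0 ?invr_gt0 // => /gt_eqF h1 /gt_eqF h2 h3.
  by field; rewrite h1 h2 h3.
have pp i j : p i * p j = s + q i + q j + q i * q j / s.
  by rewrite !pE -cc; field; rewrite gt_eqF.
have k1 i j : `|\sum_(l < 5) e l i * e l j| < 1.
  have P0 : 0 < p i * p j by rewrite mulr_gt0.
  have D0 := sqr_ge0 (cmod (x i - x j)).
  rewrite kE; set D := cmod _ ^+ 2 in D0 *.
  have t0 : 0 < (s + D) / (p i * p j) by rewrite divr_gt0 // ltr_pwDl.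
  have t1 : (s + D) / (p i * p j) < 2.
    rewrite ltr_pdivrMr // pp.
    have : 0 <= q i * q j / s by exact: divr_ge0 (mulr_ge0 (q0 i) (q0 j)) (ltW s0).
    have : D <= 2 * q i + 2 * q j.
      rewrite /D dE /q !cmod_sqr.
      have := sqr_ge0 (complex.Re (x i) + complex.Re (x j)).
      have := sqr_ge0 (complex.Im (x i) + complex.Im (x j)).
      rewrite !sqrrD; lra.
    have := q0 i; have := q0 j; lra.
  by rewrite ltr_norml; lra.
have := pos_def_geometric (fun i => mu i / p i) k1.
rewrite (_ : \sum_(i < n) _ = \sum_(i < n) \sum_(j < n) mu i * mu j / (s + cmod (x i - x j) ^+ 2)) //.
apply: eq_bigr => i _; apply: eq_bigr => j _.
rewrite kE opprB addrCA subrr addr0.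
have D0 : s + cmod (x i - x j) ^+ 2 != 0 by rewrite gt_eqF // ltr_pwDl // sqr_ge0.
by field; rewrite D0 !gt_eqF.
Qed.

(** The derivative in s is nonnegative by the previous lemma, and the sum tends to
0 when s grows because the total charge vanishes. *)
Lemma log_energy (n : nat) (x : 'I_n -> R[i]) (mu : 'I_n -> R) (s : R) :
  0 < s -> \sum_(i < n) mu i = 0 ->
  \sum_(i < n) \sum_(j < n) mu i * mu j * ln (s + cmod (x i - x j) ^+ 2) <= 0.
Proof.
move=> s0 mu0.
set Th := fun t : R => \sum_(i < n) \sum_(j < n) mu i * mu j * ln (s + t + cmod (x i - x j) ^+ 2).
pose K := \sum_(i < n) \sum_(j < n) `|mu i * mu j| * cmod (x i - x j) ^+ 2.
have K0 : 0 <= K by do 2!(apply: sumr_ge0 => ? _); rewrite mulr_ge0 ?sqr_ge0.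
have pos (t : R) i j : 0 <= t -> 0 < s + t + cmod (x i - x j) ^+ 2.
  by move=> t0; rewrite ltr_pwDl ?sqr_ge0 // ltr_pwDl.
have mono (t : R) : 0 <= t -> Th 0 <= Th t.
  move=> t0; rewrite -lerN2.
  pose dTh (t : R) := \sum_(i < n) \sum_(j < n) mu i * mu j / (s + t + cmod (x i - x j) ^+ 2).
  have dT (u : R) : 0 <= u -> is_derive u 1 Th (dTh u).
    move=> u0; apply: rderiv_sum => i; apply: rderiv_sum => j; apply: rderivZ.
    apply: rderivE (@rderiv_ln R (fun t => s + t + cmod (x i - x j) ^+ 2) u 1 (pos _ _ _ u0) _) _.
      apply: rderivE (rderivD (rderivD (rderiv_cst _ _) (rderiv_id _)) (rderiv_cst _ _)) _.
      by rewrite add0r addr0.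
    by rewrite mul1r.
  apply: (@le_of_derive_le0 R (fun t => - Th t) (fun t => - dTh t) t t0).
    move=> u /andP[u0 _].
    exact: rderivN (dT u u0).
  move=> u /andP[u0 _]; rewrite oppr_le0; apply: pos_def_resolvent.
  by rewrite ltr_pwDl.
have small (t : R) : 0 <= t -> Th t <= K / (s + t).
  move=> t0; have st : 0 < s + t by rewrite ltr_pwDl.
  have -> : Th t = \sum_(i < n) \sum_(j < n) mu i * mu j *
      ln (1 + cmod (x i - x j) ^+ 2 / (s + t)).
    have z : \sum_(i < n) \sum_(j < n) mu i * mu j * ln (s + t) = 0.
      rewrite (eq_bigr (fun i => mu i * ln (s + t) * \sum_(j < n) mu j)).
        by rewrite -mulr_suml mu0 mulr0.
      by move=> i _; rewrite mulr_sumr; apply: eq_bigr => j _; ring.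
    transitivity (Th t - \sum_(i < n) \sum_(j < n) mu i * mu j * ln (s + t)).
      by rewrite z subr0.
    rewrite -sumrB; apply: eq_bigr => i _; rewrite -sumrB.
    apply: eq_bigr => j _; rewrite -mulrBr -ln_div ?posrE ?pos //.
    by rewrite mulrDl divff // gt_eqF.
  rewrite /K mulr_suml; apply: ler_sum => i _; rewrite mulr_suml; apply: ler_sum => j _.
  set d := cmod _ ^+ 2.
  have d0 : 0 <= d / (s + t) by rewrite divr_ge0 ?sqr_ge0 // ltW.
  have l0 : 0 <= ln (1 + d / (s + t)) by rewrite ln_ge0 // lerDl.
  apply: le_trans (_ : `|mu i * mu j| * ln (1 + d / (s + t)) <= _).
    by rewrite ler_wpM2r // ler_norm.
  rewrite -mulrA ler_wpM2l // le_ln1Dx // (lt_le_trans _ d0) //.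
rewrite (_ : \sum_(i < n) _ = Th 0); last first.
  by apply: eq_bigr => i _; apply: eq_bigr => j _; rewrite addr0.
rewrite leNgt; apply/negP => T0.
pose t := (K + 1) / Th 0.
have t0 : 0 <= t by rewrite divr_ge0 ?addr_ge0 // ltW.
have := le_trans (mono _ t0) (small _ t0).
rewrite ler_pdivlMr ?ltr_pwDl // mulrDr.
have -> : Th 0 * t = K + 1 by rewrite /t mulrC divfK // gt_eqF.
have : 0 < Th 0 * s by rewrite mulr_gt0.
lra.
Qed.

End LogEnergy.

(** * The energy of a circle *)

Section CircleEnergy.
Variable R : realType.
Implicit Types (om z c : R[i]) (N M : nat) (t s : R).

(** The sum of 1 - z^j over j < N equals N, and |1 - z^j| <= j |1 - z|. *)
Lemma chord_lower N z : (0 < N)%N -> z ^+ N = 1 -> z != 1 -> cmod z = 1 ->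
  N%:R^-1 <= cmod (1 - z).
Proof.
move=> N0 zN z1 mz; have NR : 0 < N%:R :> R by rewrite ltr0n.
have le1 j : (j < N)%N -> cmod (1 - z ^+ j) <= N%:R * cmod (1 - z).
  move=> jN; rewrite cmodC subrX1 cmodM mulrC [cmod (z - 1)]cmodC.
  rewrite ler_wpM2r ?cmod_ge0 //; apply: le_trans (cmod_sum _ _ _) _.
  under eq_bigr do rewrite cmodX mz expr1n.
  by rewrite sumr_const card_ord ler_nat ltnW.
have : cmod (N%:R) <= N%:R * (N%:R * cmod (1 - z)).
  have -> : N%:R = \sum_(j < N) (1 - z ^+ j).
    by rewrite sumrB sumr_const card_ord geom_root // subr0.
  apply: le_trans (cmod_sum _ _ _) _.
  apply: le_trans (_ : \sum_(j < N) N%:R * cmod (1 - z) <= _).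
    by apply: ler_sum => j _; exact: le1.
  by rewrite sumr_const card_ord -[_ *+ N]mulr_natl.
rewrite cmod_nat -{1}[N%:R]mulr1 ler_pM2l // => h.
by rewrite -[N%:R^-1]mulr1 mulrC ler_pdivrMr // mulrC.
Qed.

Lemma mean_root_pow N om n : (0 < N)%N -> root_step N om ->
  mean (fun j : 'I_N => (om ^+ j) ^+ n) = (N %| n)%:R.
Proof.
move=> N0 h; have [oN _ _ _] := h.
have red j : (om ^+ j) ^+ n = (om ^+ j) ^+ (n %% N).
  by rewrite {1}(divn_eq n N) exprD mulnC exprM [(om ^+ j) ^+ N]exprAC oN !expr1n mul1r.
have [dv|ndv] := boolP (N %| n)%N.
  rewrite -[RHS](mean_cst (1 : R[i]) N0); congr mean; apply/funext => j.
  by rewrite red; move: dv; rewrite /dvdn => /eqP ->; rewrite expr0.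
rewrite /mean; under eq_bigr do rewrite red.
rewrite (root_sum h) ?mulr0 //; by rewrite lt0n -/(dvdn N n) ndv ltn_pmod.
Qed.

Lemma inv_geom N om j s : root_step N om -> (0 < N)%N -> 0 <= s < 1 ->
  (1 - s%:C * om ^+ j)^-1 =
  (1 - s ^+ N)^-1%:C * \sum_(n < N) (s ^+ n)%:C * (om ^+ j) ^+ n.
Proof.
move=> [oN o1 _ _] N0 /andP[s0 s1].
have n0 : 1 - s%:C * om ^+ j != 0.
  rewrite subr_eq0; apply/eqP => e.
  have : cmod 1 = cmod (s%:C * om ^+ j) by rewrite {1}e.
  by rewrite cmod1 cmodM cmodR cmodX o1 expr1n mulr1 ger0_norm //; lra.
have n1 : (1 - s ^+ N)%:C != 0 :> R[i].
  rewrite (inj_eq (@complexI R)) subr_eq0 eq_sym lt_eqF //.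
  by rewrite exprn_ilt1 // -lt0n.
rewrite fmorphV /=; apply: (mulfI n0); rewrite mulfV //.
apply: (mulfI n1); rewrite mulr1 [RHS]mulrCA mulVKf //.
under eq_bigr do rewrite rmorphXn /= -exprMn.
have := subrX1 (s%:C * om ^+ j) N.
rewrite exprMn [(om ^+ j) ^+ N]exprAC oN expr1n mulr1 -(opprB 1) -(opprB 1 (s%:C * _)) mulNr.
by move=> /oppr_inj <-; rewrite rmorphB /= rmorphXn.
Qed.

(** The parameter t < 1 regularizes the logarithm at coinciding nodes. *)
Definition circle_energy N om t : R :=
  N%:R^-1 * \sum_(j < N) complex.Re (om ^+ j) * ln (cmod (1 - t%:C * om ^+ j) ^+ 2).

(** Expanding 1 / (1 - s om^j) in a geometric series of length N, only the powers
of om^j divisible by N survive the summation over j. *)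
Lemma circle_energy_derive N om s : root_step N om -> (2 < N)%N -> 0 <= s < 1 ->
  is_derive s 1 (circle_energy N om) (- (1 + s ^+ (N - 2)) / (1 - s ^+ N)).
Proof.
move=> h N2 sI; have [oN o1 _ _] := h; have [s0 s1] := andP sI.
have N0 : (0 < N)%N by exact: ltn_trans N2.
have n0 j : 1 - s%:C * om ^+ j != 0.
  rewrite subr_eq0; apply/eqP => e.
  have : cmod 1 = cmod (s%:C * om ^+ j) by rewrite {1}e.
  by rewrite cmod1 cmodM cmodR cmodX o1 expr1n mulr1 ger0_norm //; lra.
have d1 j : is_derive s 1 (fun t => ln (cmod (1 - t%:C * om ^+ j) ^+ 2))
    (2 * complex.Re (- om ^+ j / (1 - s%:C * om ^+ j))).
  have := @derive_ln_cmod R (fun w => 1 - w) 0 (om ^+ j) (-1) s.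
  rewrite add0r mulN1r => /(_ _ (n0 j)) d1; move: d1.
  rewrite (_ : (fun t => ln (cmod (1 - (0 + t%:C * om ^+ j)) ^+ 2)) =
    (fun t => ln (cmod (1 - t%:C * om ^+ j) ^+ 2))); last first.
    by apply/funext => t; rewrite add0r.
  apply; apply: cderivE (cderivB (cderiv_cst _ _) (cderiv_id _)) _.
  by rewrite sub0r.
apply: rderivE.
  by apply: rderivZ; apply: rderiv_sum => j; apply: rderivZ; exact: d1.
have -> : N%:R^-1 * (\sum_(j < N) complex.Re (om ^+ j) *
    (2 * complex.Re (- om ^+ j / (1 - s%:C * om ^+ j)))) =
  - complex.Re (mean (fun j : 'I_N => (om ^+ j) ^+ 2 * (1 - s%:C * om ^+ j)^-1)
    + mean (fun j : 'I_N => (1 - s%:C * om ^+ j)^-1)).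
  rewrite -meanD /mean.
  have -> : (N%:R^-1 : R[i]) = (N%:R^-1)%:C by rewrite fmorphV rmorph_nat.
  rewrite ReZ Re_sum -mulrN -sumrN; congr (_ * _); apply: eq_bigr => j _.
  have oj := root_conj j h; set G := _^-1.
  have -> : (om ^+ j) ^+ 2 * G + G = om ^+ j * (om ^+ j * G) + (om ^+ j)^* * (om ^+ j * G).
    by rewrite [_^* * _]mulrA oj; ring.
  rewrite mulNr; case: (om ^+ j) (om ^+ j * G) => x y [x' y'] /=; ring.
have gE : mean (fun j : 'I_N => (1 - s%:C * om ^+ j)^-1) = (1 - s ^+ N)^-1%:C.
  rewrite (_ : (fun j : 'I_N => _) = fun j : 'I_N => (1 - s ^+ N)^-1%:C *
     \sum_(n < N) (s ^+ n)%:C * (om ^+ j) ^+ n); last first.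
    by apply/funext => j; rewrite (inv_geom j h).
  rewrite meanZ {1}/mean exchange_big mulr_sumr /=.
  rewrite (bigD1 (Ordinal N0)) //= [X in _ * (_ + X)]big1 ?addr0.
    rewrite expr0 rmorph1; under eq_bigr do rewrite mul1r expr0.
    by rewrite sumr_const card_ord mulVf ?mulr1 // pnatr_eq0 -lt0n.
  move=> n n1; rewrite -mulr_sumr mulrCA.
  have := mean_root_pow n N0 h; rewrite /mean => ->.
  rewrite gtnNdvd ?mulr0 //.
  by rewrite lt0n; apply: contra n1 => /eqP e; apply/eqP/val_inj.
have N2' : (N - 2 < N)%N by rewrite -[X in (_ < X)%N]subn0 ltn_sub2l.
have gE2 : mean (fun j : 'I_N => (om ^+ j) ^+ 2 * (1 - s%:C * om ^+ j)^-1) =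
    (1 - s ^+ N)^-1%:C * (s ^+ (N - 2))%:C.
  rewrite (_ : (fun j : 'I_N => _) = fun j : 'I_N => (1 - s ^+ N)^-1%:C *
     \sum_(n < N) (s ^+ n)%:C * (om ^+ j) ^+ (n + 2)); last first.
    apply/funext => j; rewrite (inv_geom j h) // mulrCA mulr_sumr; congr (_ * _).
    by apply: eq_bigr => n _; rewrite exprD; ring.
  rewrite meanZ {1}/mean exchange_big mulr_sumr /=.
  rewrite (bigD1 (Ordinal N2')) //= [X in _ * (_ + X)]big1 ?addr0.
    rewrite -mulr_sumr [N%:R^-1 * _]mulrCA; have := mean_root_pow (N - 2 + 2) N0 h.
    by rewrite /mean => ->; rewrite subnK ?dvdnn ?mulr1 // ltnW.
  move=> n n1; rewrite -mulr_sumr mulrCA.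
  have := mean_root_pow (n + 2) N0 h; rewrite /mean => ->.
  rewrite (_ : (N %| n + 2)%N = false) ?mulr0 //; apply/negP => /dvdnP[q e].
  have nN := ltn_ord n.
  have q1 : q = 1%N.
    apply/eqP; rewrite eqn_leq; apply/andP; split.
      rewrite leqNgt; apply/negP => q2.
      have : (2 * N <= n + 2)%N by rewrite e leq_mul2r q2 orbT.
      rewrite mul2n -addnn => h2.
      have : (n + 2 < N + N)%N by rewrite -addSn leq_add // ltnW.
      by rewrite ltnNge h2.
    by rewrite lt0n; apply/negP => /eqP q0; move: e; rewrite q0 mul0n addn2.
  move/negP: n1; apply; apply/eqP/val_inj => /=.
  by apply/eqP; rewrite -(eqn_add2r 2) e q1 mul1n subnK // ltnW.
rewrite gE gE2 -rmorphM -rmorphD /=; ring.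
Qed.

(** The derivative is at least -1 - 2 s^(M-1) / (1 - s^M), which is explicitly
integrable; the logarithm carries the factor 1/M and is negligible even when
1 - t is a negative power of M. *)
Lemma circle_energy_ge M om t : root_step (2 * M) om -> (1 < M)%N -> 0 <= t < 1 ->
  - t + 2 / M%:R * ln (1 - t ^+ M) <= circle_energy (2 * M) om t.
Proof.
move=> h M1 /andP[t0 t1].
have N2 : (2 < 2 * M)%N by lia.
have M0 : (0 < M)%N by exact: ltn_trans M1.
have MR : 0 < M%:R :> R by rewrite ltr0n.
have xM s : 0 <= s < 1 -> 0 < 1 - s ^+ M.
  by move=> /andP[s0 s1]; rewrite subr_gt0 exprn_ilt1 // -lt0n.
have := @le_of_derive_le0 R
  (fun s => - s + 2 / M%:R * ln (1 - s ^+ M) - circle_energy (2 * M) om s)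
  (fun s => - 1 + 2 / M%:R * (- (M%:R * s ^+ M.-1) / (1 - s ^+ M))
     - (- (1 + s ^+ (2 * M - 2)) / (1 - s ^+ (2 * M)))) t t0.
have -> : circle_energy (2 * M) om 0 = 0.
  rewrite /circle_energy big1 ?mulr0 // => j _.
  by rewrite mul0r subr0 cmod1 expr1n ln1 mulr0.
have -> : (0 : R) ^+ M = 0 by rewrite expr0n; case: M M0 {h M1 N2 MR xM}.
rewrite !subr0 ln1 mulr0 oppr0 addr0 => H.
rewrite -subr_le0; apply: H.
  move=> s /andP[s0 st]; have sI : 0 <= s < 1 by rewrite s0 (le_lt_trans st).
  apply: rderivB; last exact: circle_energy_derive.
  apply: (@rderivD R (fun s => - s) (fun s => 2 / M%:R * ln (1 - s ^+ M)) s (- 1)).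
  apply: rderivZ; apply: rderivE (@rderiv_ln R (fun s => 1 - s ^+ M) s _ (xM _ sI)
    (rderivB (rderiv_cst _ _) (rderivX M (rderiv_id s)))) _.
  by rewrite sub0r mulr1.
move=> s /andP[s0 st]; have sI : 0 <= s < 1 by rewrite s0 (le_lt_trans st).
have := xM _ sI; case/andP: (sI) => _ s1.
have -> : (2 * M - 2 = 2 * M.-1)%N by rewrite -[M in LHS](prednK M0) mulnS addKn.
rewrite !(mulnC 2) !exprM.
have y1 : s ^+ M.-1 <= 1 by rewrite exprn_ile1 // ltW.
have y0 : 0 <= s ^+ M.-1 by rewrite exprn_ge0.
have : s ^+ M = s * s ^+ M.-1 by rewrite -exprS prednK.
set x := s ^+ M; set y := s ^+ M.-1 in y0 y1 * => xE x1.
have x0 : 0 <= x by rewrite xE mulr_ge0.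
have xy : x <= y by rewrite xE ler_piMl // ltW.
have x2 : 0 < 1 - x ^+ 2.
  have -> : 1 - x ^+ 2 = (1 - x) * (1 + x) by ring.
  by rewrite mulr_gt0 //; lra.
rewrite -(pmulr_rle0 _ x2).
have -> : (1 - x ^+ 2) * (-1 + 2 / M%:R * (- (M%:R * y) / (1 - x)) - - (1 + y ^+ 2) / (1 - x ^+ 2))
   = - (1 - x ^+ 2) - 2 * y * (1 + x) + (1 + y ^+ 2).
  by field; rewrite !gt_eqF.
nra.
Qed.

Lemma sum_shift N om k (G : R[i] -> R) : om ^+ N = 1 ->
  \sum_(j < N) G (om ^+ (j + k)) = \sum_(j < N) G (om ^+ j).
Proof.
move=> oN; elim: k => [|k <-]; first by under eq_bigr do rewrite addn0.
case: N oN => [|N] oN; first by rewrite !big_ord0.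
rewrite big_ord_recr big_ord_recl /= addrC; congr (_ + _).
  by rewrite addnS -addSn exprD oN mul1r add0n.
by apply: eq_bigr => j _; rewrite /bump /= addnS addSn.
Qed.

(** The kernel is invariant under rotation, so a double sum over pairs of nodes
reduces to a sum over their quotient; the average of the product of the two
charges over all pairs with quotient om^j is Re om^j / 2. *)
Lemma charge_energy_circle N om c (F : R[i] -> R) : root_step N om -> (2 < N)%N ->
  cmod c = 1 ->
  \sum_(k < N) \sum_(j < N) charge c om j * charge c om k * F (om ^+ j * (om ^+ k)^*) =
  N%:R / 2 * \sum_(j < N) complex.Re (om ^+ j) * F (om ^+ j).
Proof.
move=> h N2 c1; have [oN o1 _ _] := h.
have step (k : 'I_N) :
    \sum_(j < N) charge c om j * charge c om k * F (om ^+ j * (om ^+ k)^*) =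
    \sum_(j < N) complex.Re (c * (om ^+ j)^* * (om ^+ k)^*) * charge c om k * F (om ^+ j).
  rewrite -(sum_shift k (fun z => complex.Re (c * z^*) * charge c om k * F (z * (om ^+ k)^*)) oN).
  apply: eq_bigr => j _; rewrite exprD rmorphM /= mulrA -[om ^+ j * _ * _]mulrA.
  by rewrite [om ^+ k * _]mulrC (root_conj k h) mulr1.
rewrite (eq_bigr _ (fun k _ => step k)) exchange_big mulr_sumr; apply: eq_bigr => j _.
rewrite -mulr_suml mulrA; congr (_ * _).
have cc : c * c^* = 1 by rewrite mul_conj c1 expr1n.
have e (k : 'I_N) : complex.Re (c * (om ^+ j)^* * (om ^+ k)^*) * charge c om k =
    2^-1 * complex.Re (c ^+ 2 * (om ^+ j)^* * ((om ^+ k)^*) ^+ 2 + (om ^+ j)^*).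
  have -> : c ^+ 2 * (om ^+ j)^* * ((om ^+ k)^*) ^+ 2 + (om ^+ j)^* =
    (c * (om ^+ j)^* * (om ^+ k)^*) * (c * (om ^+ k)^*) +
    (c * (om ^+ j)^* * (om ^+ k)^*) * (c * (om ^+ k)^*)^*.
    rewrite rmorphM /= conjCK.
    have -> : c * (om ^+ j)^* * (om ^+ k)^* * (c^* * om ^+ k) =
      (om ^+ j)^* * (c * c^*) * ((om ^+ k)^* * om ^+ k) by ring.
    by rewrite cc (root_conj k h); ring.
  rewrite /charge; set A := c * (om ^+ j)^* * _; set B := c * (om ^+ k)^*.
  clearbody A B; case: A B => x y [x' y'] /=; by field.
rewrite (eq_bigr _ (fun k _ => e k)) -mulr_sumr -Re_sum big_split /= -mulr_sumr.
rewrite (root_sum_conj h) // mulr0 add0r sumr_const card_ord.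
have -> : complex.Re ((om ^+ j)^* *+ N) = N%:R * complex.Re (om ^+ j).
  rewrite -[_ *+ N]mulr_natl -(rmorph_nat (real_complex R)) ReZ.
  by case: (om ^+ j).
ring.
Qed.

End CircleEnergy.

(** * Inverse branches of a polynomial *)

Section InverseBranch.
Variable R : realType.
Implicit Types (f : {poly R[i]}) (g : R[i] -> R[i]) (a w z : R[i]) (d r : R).

Lemma cderiv_local (phi psi : R[i] -> R[i]) w (dl : R) (k : R[i]) : 0 < dl ->
  (forall u, cmod (u - w) < dl -> phi u = psi u) -> cderiv phi w k -> cderiv psi w k.
Proof.
move=> dl0 e h; apply: cderiv_of_approx => eps e0.
have [d1 d10 H] := cderiv_approx h e0.
exists (Num.min d1 dl); first by rewrite lt_min d10.
move=> u; rewrite lt_min => /andP[/H h1 /e eu].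
by rewrite -eu -(e w) // subrr cmod0.
Qed.

Definition disc_branch f a d g : Prop :=
  (forall w, cball a d w -> f.[g w] = w) /\
  (forall w, cball a d w -> exists k, cderiv g w k).

Lemma cball_sub a w d r : cmod (w - a) + r <= d -> forall z, cball w r z -> cball a d z.
Proof.
rewrite /cball => h z hz; apply: le_lt_trans (cmod_tri z a w) _; lra.
Qed.

Lemma disc_branch_sub f a w d r g : cmod (w - a) + r <= d ->
  disc_branch f a d g -> disc_branch f w r g.
Proof.
by move=> h [h1 h2]; split => z hz; [apply: h1 | apply: h2]; apply: cball_sub hz.
Qed.

Lemma branch_deriv f a d g w : disc_branch f a d g -> cball a d w ->
  f^`().[g w] != 0 /\ cderiv g w (f^`().[g w])^-1.
Proof.
move=> [h1 h2] hw; have [k hk] := h2 _ hw.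
have hc := cderiv_comp hk (cderiv_horner f (g w)).
have : cderiv id w (f^`().[g w] * k).
  apply: (@cderiv_local _ _ w (d - cmod (w - a)) _ _ _ hc); first by rewrite subr_gt0.
  by move=> u hu; rewrite h1 //; apply: (@cball_sub a w d (d - cmod (w - a))) => //; lra.
move=> /(cderiv_uniq (cderiv_id w)) e.
have n0 : f^`().[g w] != 0.
  by apply: contra_eq_neq (esym e) => ->; rewrite mul0r eq_sym oner_eq0.
split => //; apply: cderivE hk _.
by apply: (mulfI n0); rewrite -e mulfV.
Qed.

Lemma branch_deriv_lower f a d g r : 0 <= r < d -> disc_branch f a d g ->
  exists2 m : R, 0 < m & forall w, cball a r w -> m <= cmod f^`().[g w].
Proof.
move=> /andP[r0 rd] h.
have hb w : cmod (w - a) <= r -> cball a d w by move=> h1; exact: le_lt_trans rd.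
have [|w0 w0r w0max] := @disc_max R (fun w => - cmod f^`().[g w]) a r r0.
  move=> w /hb hw; have [_ dg] := branch_deriv h hw.
  have c1 := cderiv_ccont (cderiv_comp dg (cderiv_horner f^`() (g w))).
  have c2 := rcont_cmod c1.
  move=> e e0; have [dl dl0 H] := c2 e e0; exists dl => // u /H.
  by rewrite -opprD normrN.
exists (cmod f^`().[g w0]).
  by have [n0 _] := branch_deriv h (hb _ w0r); rewrite cmod_gt0.
by move=> w hw; have := w0max w (ltW hw); rewrite lerN2.
Qed.

(** The divided difference (f x - f y) / (x - y), written so that it makes sense
for x = y. *)
Definition diffquot f x y : R[i] :=
  \sum_(k < size f) f`_k * \sum_(i < k) x ^+ (k.-1 - i) * y ^+ i.

Lemma diffquotE f x y : (x - y) * diffquot f x y = f.[x] - f.[y].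
Proof.
rewrite !horner_coef -sumrB mulr_sumr; apply: eq_bigr => k _.
by rewrite mulrCA -subrXX mulrBr.
Qed.

Lemma diffquot_diag f x : diffquot f x x = f^`().[x].
Proof.
rewrite /diffquot (@horner_coef_wide _ (size f).-1); last exact: size_poly.
case sf : (size f) => [|n].
  by rewrite big_ord0 big_ord0.
rewrite big_ord_recl big_ord0 mulr0 add0r /=.
apply: eq_bigr => k _; rewrite coef_deriv /bump /= add1n.
rewrite (eq_bigr (fun=> x ^+ k)); last first.
  by move=> i _; rewrite -exprD subnK // -ltnS.
by rewrite sumr_const card_ord mulrnAr mulrnAl.
Qed.

Lemma tame_diffquot a r k f (F G : R[i] -> R[i] -> R[i]) :
  tame a r k F -> tame a r k G -> tame a r k (fun y w => diffquot f (F y w) (G y w)).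
Proof.
move=> tF tG; apply: tame_sum => l; apply: tameM; first exact: tame_cst.
by apply: tame_sum => i; apply: tameM; exact: tameX.
Qed.

(** Up to the factor -6, the Schwarzian derivative at w of the branch g of the
inverse of f, in terms of x = g w. *)
Definition schwarz f x : R[i] :=
  (f^`()^`()^`().[x] / 6 * f^`().[x] - f^`()^`().[x] ^+ 2 / 4) / f^`().[x] ^+ 4.

(** Expansion at y = x of the divided differences p(y) = f[x, y] and
q(y) = f[x, x, y], by repeated differentiation of f - f(x) = p (X - x). *)
Lemma divided_difference f x :
  exists p q : {poly R[i]},
    [/\ f - f.[x]%:P = p * ('X - x%:P), p - p.[x]%:P = q * ('X - x%:P),
        p.[x] = f^`().[x], q.[x] = f^`()^`().[x] / 2 &
        p^`().[x] = f^`()^`().[x] / 2 /\ q^`().[x] = f^`()^`()^`().[x] / 6].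
Proof.
have quo (p : {poly R[i]}) : exists q, p - p.[x]%:P = q * ('X - x%:P).
  by apply/factor_theorem; rewrite rootE !hornerE subrr.
have ev (p q : {poly R[i]}) : p - p.[x]%:P = q * ('X - x%:P) ->
  [/\ p^`().[x] = q.[x], p^`()^`().[x] = 2 * q^`().[x] &
      p^`()^`()^`().[x] = 3 * q^`()^`().[x]].
  move=> e.
  have e1 : p^`() = q^`() * ('X - x%:P) + q.
    by have := congr1 (@deriv R[i]) e; rewrite derivB derivC subr0 derivM derivXsubC mulr1.
  have e2 : p^`()^`() = q^`()^`() * ('X - x%:P) + q^`() + q^`().
    by rewrite e1 derivD derivM derivXsubC mulr1.
  have e3 : p^`()^`()^`() = q^`()^`()^`() * ('X - x%:P) + q^`()^`() + q^`()^`() + q^`()^`().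
    by rewrite e2 !derivD derivM derivXsubC mulr1.
  by rewrite e3 e2 e1 !hornerE subrr; split; ring.
have [p pE] := quo f; have [q qE] := quo p; exists p, q.
have [f1 f2 f3] := ev _ _ pE; have [p1 p2 _] := ev _ _ qE.
have q1 : q.[x] = f^`()^`().[x] / 2 by rewrite -p1 f2; field.
split => //; rewrite ?f1 //; split; first by rewrite p1.
by rewrite f3 p2; field.
Qed.

End InverseBranch.

(** * The Schwarzian bound *)

Section SchwarzianBound.
Variable R : realType.
Implicit Types (f : {poly R[i]}) (g : R[i] -> R[i]) (a w z c om : R[i]) (d r rho : R).

(** The lower bound on f' makes g Lipschitz, and the divided difference is the
inverse of the difference quotient of g. *)
Lemma diffquot_lower f a d g r (m : R) : disc_branch f a d g -> r <= d -> 0 < m ->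
  (forall w, cball a r w -> m <= cmod f^`().[g w]) ->
  forall y w, cball a r y -> cball a r w -> m <= cmod (diffquot f (g w) (g y)).
Proof.
move=> h rd m0 hm y w hy hw.
have sub z : cball a r z -> cball a d z by rewrite /cball => hz; exact: lt_le_trans rd.
have [->|wy] := eqVneq w y; first by rewrite diffquot_diag hm.
have le1 : cmod (g w - g y) <= m^-1 * cmod (w - y).
  apply: (@mean_value_ineq R g (fun z => (f^`().[g z])^-1) a y w r) => //.
    by move=> u hu; have [_] := branch_deriv h (sub _ hu).
  by move=> u hu; rewrite cmodV lef_pV2 ?posrE ?hm // (lt_le_trans m0) // hm.
have e : w - y = (g w - g y) * diffquot f (g w) (g y).
  by rewrite diffquotE !h.1 //; exact: sub.
have p0 : 0 < cmod (w - y) by rewrite cmod_gt0 subr_eq0.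
have e2 : cmod (w - y) = cmod (g w - g y) * cmod (diffquot f (g w) (g y)).
  by rewrite -cmodM -e.
rewrite -(ler_pM2r p0) {1}e2 mulrA [X in _ <= X]mulrC ler_wpM2r ?cmod_ge0 //.
by rewrite mulrC -ler_pdivlMr // mulrC.
Qed.

(** Summation over j extracts the logarithmic derivative of the divided difference
in its first variable at the centre, a function beta of the second variable;
summation over k then extracts the derivative of beta, which is the Schwarzian. *)
Lemma charge_energy_diffquot f a d g rho : 0 < rho < d -> disc_branch f a d g ->
  exists2 K : R, 0 <= K & forall N om c, root_step N om -> (2 < N)%N -> cmod c = 1 ->
  `|N%:R^-1 ^+ 2 * (\sum_(k < N) \sum_(j < N) charge c om j * charge c om k *
      ln (cmod (diffquot f (g (node a om rho j)) (g (node a om rho k))) ^+ 2))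
    - rho ^+ 2 / 2 * complex.Re (c ^+ 2 * schwarz f (g a))| <= K / N%:R.
Proof.
move=> /andP[rho0 rhod] h; set r := (rho + d) / 2.
have rr : rho < r by rewrite /r; lra.
have rd : r < d by rewrite /r; lra.
have r0 : 0 <= r < d by rewrite rd andbT; lra.
have [m m0 hm] := branch_deriv_lower r0 h.
have sub z : cball a r z -> cball a d z by rewrite /cball => hz; exact: lt_trans rd.
have ha : cball a r a by rewrite /cball subrr cmod0; lra.
have dg w : cball a r w -> cderiv g w (f^`().[g w])^-1.
  by move=> hw; have [] := branch_deriv h (sub _ hw).
have tg k : tame a r k (fun _ w => g w) by exact: tame_inverse m0 dg hm.
have tgy k : tame a r k (fun y _ => g y).
  apply: tame_param; have [B hB] := tame_bounded (tg 0%N); exists B => y hya.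
  exact: (hB y y).
have tP k := tame_diffquot f (tg k) (tgy k).
have hP := diffquot_lower h (ltW rd) m0 hm.
have [_ [P1 dP tP1]] := tP 3%N.
have [C1 C10 H1] := charge_mean_ln m0 hP dP (tP 2%N) tP1.
set x := g a; have [p [q [pE qE px qx [dpx dqx]]]] := divided_difference f x.
have fx : f.[x] = a by rewrite /x h.1 //; exact: sub.
have f'0 : f^`().[x] != 0 by have [] := branch_deriv h (sub _ ha).
have pD y : cball a r y -> y != a -> diffquot f x (g y) = p.[g y].
  move=> hy ya; have := congr1 (horner^~ (g y)) pE; rewrite /= !hornerE => e.
  have n0 : x - g y != 0.
    rewrite subr_eq0; apply: contra_neq ya => e'.
    by rewrite -fx e' h.1 //; exact: sub.
  apply: (mulfI n0); rewrite diffquotE; apply: oppr_inj.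
  by rewrite opprB e; ring.
have hp y : cball a r y -> m <= cmod p.[g y].
  move=> hy; have [->|ya] := eqVneq y a; first by rewrite px hm.
  by rewrite -pD // hP.
(* f[x, x, y] / (f'(x) f[x, y]) at y = g(.), the logarithmic derivative above *)
pose beta y := q.[g y] * (f^`().[x] * p.[g y])^-1.
have tb : tame a r 3 (fun _ : R[i] => beta).
  apply: tameM; first exact: (@tame_horner _ _ _ _ q (fun _ => g)).
  apply: (@tameV _ _ _ _ (fun _ y => f^`().[x] * p.[g y]) (m * m)).
  - by rewrite mulr_gt0.
  - by move=> _ y _ hy; rewrite cmodM ler_pM ?hp ?hm // ltW.
  - apply: tameM; first exact: tame_cst.
    exact: (@tame_horner _ _ _ _ p (fun _ => g)).
have [_ [b1 db tb1]] := tb.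
have [C2 C20 H2] := charge_mean db (tameS tb) tb1.
have b1E : b1 a a = schwarz f x.
  apply: (cderiv_uniq (db _ _ ha ha)).
  have pa0 : p.[g a] != 0 by rewrite px.
  have da := dg _ ha.
  have dq := cderiv_comp da (cderiv_horner q (g a)).
  have dp := cderiv_comp da (cderiv_horner p (g a)).
  have n0 : f^`().[x] * p.[g a] != 0 by rewrite mulf_neq0.
  apply: cderivE (cderivM dq (@cderivV R (fun y => f^`().[x] * p.[g y]) a _ n0
    (cderivM (cderiv_cst f^`().[x] a) dp))) _.
  rewrite -/x px qx dpx dqx /schwarz; field.
  by rewrite f'0.
have betaE y : cball a r y -> y != a -> P1 y a / diffquot f x (g y) = beta y.
  move=> hy ya.
  have n0 : x - g y != 0.
    rewrite subr_eq0; apply: contra_neq ya => e'.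
    by rewrite -fx e' h.1 //; exact: sub.
  have d1 := cderivM (cderivB (dg _ ha) (cderiv_cst (g y) a)) (dP _ _ hy ha).
  have : cderiv (fun w => w - y) a
      (((f^`().[g a])^-1 - 0) * diffquot f (g a) (g y) + (g a - g y) * P1 y a).
    apply: (@cderiv_local _ _ _ a r _ _ _ d1); first by move: ha; rewrite /cball subrr cmod0.
    by move=> u hu; rewrite diffquotE !h.1 //; exact: sub.
  have d2 := cderivB (cderiv_id a) (cderiv_cst y a).
  move=> /(cderiv_uniq d2); rewrite !subr0 -/x pD // => e.
  have := congr1 (horner^~ (g y)) qE; rewrite /= !hornerE px => e2.
  have P1E : P1 y a = q.[g y] / f^`().[x].
    apply: (mulfI n0).
    have -> : (x - g y) * P1 y a = 1 - (f^`().[x])^-1 * p.[g y] by rewrite e; ring.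
    have -> : p.[g y] = f^`().[x] + q.[g y] * (g y - x) by rewrite -e2; ring.
    by field.
  by rewrite P1E /beta invfM mulrA.
exists (C1 + rho * C2); first by rewrite addr_ge0 // mulr_ge0 // ltW.
move=> N om c hom N2 c1; have [oN o1 _ _] := hom.
have N0 : (0 < N)%N by exact: ltn_trans N2.
have NR : 0 < N%:R :> R by rewrite ltr0n.
have rI : 0 <= rho < r by rewrite (ltW rho0).
have hk k : cball a r (node a om rho k) by apply: on_circle => //; exact: ltW.
have ka k : node a om rho k != a.
  rewrite /node -subr_eq0 addrAC subrr add0r mulf_neq0 //.
    by rewrite (inj_eq (@complexI R)) gt_eqF.
  by rewrite -cmod_eq0 cmodX o1 expr1n oner_eq0.
pose X k := N%:R^-1 * \sum_(j < N) charge c om j *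
   ln (cmod (diffquot f (g (node a om rho j)) (g (node a om rho k))) ^+ 2).
have hX k : `|X k - rho * complex.Re (c * beta (node a om rho k))| <= C1 / N%:R.
  by rewrite -betaE //; exact: H1.
have -> : N%:R^-1 ^+ 2 * (\sum_(k < N) \sum_(j < N) charge c om j * charge c om k *
      ln (cmod (diffquot f (g (node a om rho j)) (g (node a om rho k))) ^+ 2)) =
   N%:R^-1 * \sum_(k < N) charge c om k * X k.
  rewrite expr2 -mulrA; congr (_ * _); rewrite mulr_sumr; apply: eq_bigr => k _.
  rewrite /X mulrCA; congr (_ * _); rewrite mulr_sumr; apply: eq_bigr => j _; ring.
have := H2 _ _ _ _ _ hom (ltnW N2) rI ha c1.
rewrite b1E; set E := mean _ => hE.
have ReE : N%:R^-1 * (\sum_(k < N) charge c om k * (rho * complex.Re (c * beta (node a om rho k)))) =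
    rho * complex.Re (c * E).
  rewrite /E -meanZ /mean.
  have -> : (N%:R^-1 : R[i]) = (N%:R^-1)%:C by rewrite fmorphV rmorph_nat.
  rewrite ReZ Re_sum mulrCA; congr (_ * _); rewrite mulr_sumr; apply: eq_bigr => k _.
  by rewrite [c * (_ * _)]mulrCA ReZ; ring.
have -> : rho ^+ 2 / 2 * complex.Re (c ^+ 2 * schwarz f x) =
    rho * complex.Re (c * (c * rho%:C * schwarz f x / 2)).
  have -> : c * (c * rho%:C * schwarz f x / 2) = (rho / 2)%:C * (c ^+ 2 * schwarz f x).
    by rewrite rmorphM fmorphV /= rmorph_nat; ring.
  by rewrite ReZ; ring.
set Z := c * rho%:C * _ / 2 in hE *.
have -> : N%:R^-1 * (\sum_(k < N) charge c om k * X k) - rho * complex.Re (c * Z) =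
   N%:R^-1 * (\sum_(k < N) charge c om k * (X k - rho * complex.Re (c * beta (node a om rho k))))
   + rho * complex.Re (c * (E - Z)).
  under [in RHS]eq_bigr do rewrite mulrBr.
  by rewrite sumrB mulrBr ReE mulrBr ReB; ring.
apply: le_trans (ler_normD _ _) _; rewrite mulrDl lerD //.
  rewrite normrM ger0_norm ?invr_ge0 ?ler0n // mulrC ler_pdivrMr // divfK ?gt_eqF //.
  apply: le_trans (ler_norm_sum _ _ _) _.
  apply: le_trans (_ : \sum_(k < N) C1 / N%:R <= _); last first.
    by rewrite sumr_const card_ord -[_ *+ N]mulr_natr divfK ?gt_eqF.
  apply: ler_sum => k _; rewrite normrM -[C1 / _]mul1r ler_pM //.
  exact: charge_le1.
rewrite normrM (ger0_norm (ltW rho0)) -mulrA ler_pM2l //.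
have := normc_ge_Re (c * (E - Z)).
by rewrite cmodE lecR cmodM c1 mul1r => h3; exact: le_trans h3 hE.
Qed.

End SchwarzianBound.

Section SchwarzianBoundProof.
Variable R : realType.
Implicit Types (f : {poly R[i]}) (g : R[i] -> R[i]) (a w z c om : R[i]) (d r rho : R).

(** Here ln (4 q^2) = 2 ln (2 q) <= 4 q, so the right-hand side is O(1/q). *)
Lemma le0_of_log_growth (u K L : R) : 0 <= K -> 0 <= L ->
  (forall q : nat, (0 < q)%N ->
     u <= (K + L * ln (4 * q ^ 2)%N%:R) / (4 * q ^ 2)%N%:R) -> u <= 0.
Proof.
move=> K0 L0 H; rewrite leNgt; apply/negP => u0.
have b0 : 0 <= (K + 4 * L) / u by rewrite divr_ge0 ?addr_ge0 ?mulr_ge0 // ltW.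
have := archi_boundP b0; set q := Num.bound _ => hq.
have q0 : 0 < q%:R :> R by exact: le_lt_trans hq.
have q1 : (0 < q)%N by rewrite ltr0n in q0.
have q1R : 1 <= q%:R :> R by rewrite ler1n.
have := H q q1; rewrite natrM natrX.
have -> : 4%:R * q%:R ^+ 2 = (2 * q%:R) ^+ 2 :> R by rewrite exprMn; ring.
have p0 : 0 < 2 * q%:R :> R by rewrite mulr_gt0.
rewrite lnXn // ler_pdivlMr ?exprn_gt0 // => h1.
have h2 := ln_sublinear p0.
move: hq; rewrite ltr_pdivrMr // => hq.
have h3 : L * (ln (2 * q%:R) *+ 2) <= L * (4 * q%:R).
  by rewrite ler_wpM2l // mulr2n; lra.
have h4 : (K + 4 * L) * q%:R < q%:R * u * q%:R by rewrite ltr_pM2r.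
have h5 : 0 <= K * (q%:R - 1) by rewrite mulr_ge0 // subr_ge0.
have h6 : 0 <= u * q%:R ^+ 2 by rewrite mulr_ge0 ?sqr_ge0 // ltW.
move: h1 h6; rewrite exprMn; nra.
Qed.

Lemma ln_regularize (eps X : R) : 0 <= eps -> 0 < X ->
  0 <= ln (eps + X) - ln X <= eps / X.
Proof.
move=> e0 X0; have eX : 0 < eps + X by rewrite ltr_wpDl.
rewrite -ln_div ?posrE // mulrDl divff ?gt_eqF // addrC.
have q0 : 0 <= eps / X by rewrite divr_ge0 // ltW.
by rewrite ln_ge0 ?lerDl //= le_ln1Dx // (lt_le_trans _ q0).
Qed.

Lemma ln_contract (Q de : R) : 0 < de <= 2^-1 -> de <= Q ->
  0 <= ln Q - ln (Q - de * Q + de ^+ 2) <= 2 * de.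
Proof.
move=> /andP[d0 d1] dQ; have Q0 : 0 < Q by exact: lt_le_trans dQ.
have dd : de ^+ 2 <= de * Q by rewrite expr2 ler_pM2l.
set T := Q - de * Q + de ^+ 2.
have T1 : 2^-1 * Q <= T.
  have : de * Q <= 2^-1 * Q by rewrite ler_pM2r.
  by rewrite /T; have := sqr_ge0 de; lra.
have T0 : 0 < T by apply: lt_le_trans T1; rewrite mulr_gt0.
have TQ : T <= Q by rewrite /T; lra.
rewrite subr_ge0 ler_ln ?posrE // TQ /= -ln_div ?posrE //.
have -> : Q / T = 1 + (Q - T) / T by rewrite mulrBl divff ?gt_eqF //; ring.
apply: le_trans (le_ln1Dx _) _.
  by apply: lt_le_trans (_ : 0 <= _); [lra | rewrite divr_ge0 ?subr_ge0 // ltW].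
rewrite ler_pdivrMr // -mulrA; apply: le_trans (_ : de * Q <= _).
  by rewrite /T; have := sqr_ge0 de; lra.
have : de * (2^-1 * Q) <= de * T by rewrite ler_pM2l.
lra.
Qed.

Lemma cmod_one_sub (t : R) z : cmod z = 1 ->
  cmod (1 - t%:C * z) ^+ 2 =
  cmod (1 - z) ^+ 2 - (1 - t) * cmod (1 - z) ^+ 2 + (1 - t) ^+ 2.
Proof.
move=> z1; have := cmod_sqr z; rewrite z1 expr1n !cmod_sqr.
case: z {z1} => x y /= h.
apply/eqP; rewrite -subr_eq0; apply/eqP.
have h0 : x ^+ 2 + y ^+ 2 - 1 = 0 by rewrite -h subrr.
transitivity ((x ^+ 2 + y ^+ 2 - 1) * (t ^+ 2 - t)); last by rewrite h0 mul0r.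
ring.
Qed.

(** Charges of total mass zero placed at the images of the nodes have nonnegative
energy. Since g w - g w' is w - w' divided by the divided difference of f, this
energy is that of the circle corrected by the Schwarzian, and the phase of the
cosine can be chosen so that the correction has the unfavourable sign. *)
Lemma schwarz_bound f a d g rho : 0 < rho < d -> disc_branch f a d g ->
  rho ^+ 2 * cmod (schwarz f (g a)) <= 1.
Proof.
move=> /[dup] rI /andP[rho0 rhod] h.
have [K K0 HK] := charge_energy_diffquot rI h.
set S := schwarz f (g a).
have [u u1 uS] := unit_align S.
pose c := sqrtC (- u).
have c2 : c ^+ 2 = - u by rewrite sqrtCK.
have c1 : cmod c = 1.
  by apply/eqP; rewrite -(@eqrXn2 _ 2) ?cmod_ge0 // -cmodX c2 cmodN u1 expr1n.
set r := (rho + d) / 2.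
have rr : rho < r by rewrite /r; lra.
have rd : r < d by rewrite /r; lra.
have r0 : 0 <= r < d by rewrite rd andbT; lra.
have [m m0 hm] := branch_deriv_lower r0 h.
have sub z : cball a r z -> cball a d z by rewrite /cball => hz; exact: lt_trans rd.
have dg w : cball a r w -> cderiv g w (f^`().[g w])^-1.
  by move=> hw; have [] := branch_deriv h (sub _ hw).
have tg : tame a r 0 (fun _ w => g w) by exact: tame_inverse m0 dg hm.
have tgy : tame a r 0 (fun y _ => g y).
  by apply: tame_param; have [B hB] := tame_bounded tg; exists B => y hya; exact: (hB y y).
have [PB hPB] := tame_bounded (tame_diffquot f tg tgy).
have hP := diffquot_lower h (ltW rd) m0 hm.
pose K1 := PB ^+ 2 / rho ^+ 2 + 2.
pose K2 := `|ln (rho ^+ 2)| + `|ln (m ^+ 2)| + `|ln (PB ^+ 2)|.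
have K10 : 0 <= K1 by rewrite addr_ge0 // divr_ge0 ?sqr_ge0.
have K20 : 0 <= K2 by rewrite !addr_ge0.
suff H q : (0 < q)%N -> (rho ^+ 2 * cmod S - 1) / 2 <=
   (K1 + K2 + K + 5 * ln (4 * q ^ 2)%N%:R) / (4 * q ^ 2)%N%:R.
  have := le0_of_log_growth (addr_ge0 (addr_ge0 K10 K20) K0) (ler0n R 5) H; lra.
move=> q0; set N := (4 * q ^ 2)%N; pose M := (2 * q ^ 2)%N.
have q2 : (0 < q ^ 2)%N by rewrite expn_gt0 q0.
have NM : N = (2 * M)%N by rewrite /N /M mulnA.
have NMR : N%:R = 2 * M%:R :> R by rewrite -natrM -NM.
have M1 : (1 < M)%N by rewrite /M; lia.
have N2 : (2 < N)%N by rewrite /N; lia.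
have N0 : (0 < N)%N by exact: ltn_trans N2.
have NR : 0 < N%:R :> R by rewrite ltr0n.
have MR : 0 < M%:R :> R by rewrite ltr0n (ltn_trans _ M1).
have N1R : 1 <= N%:R :> R by rewrite ler1n.
have lnN : 0 <= ln N%:R :> R by rewrite ln_ge0.
have [om hom] := root_step_exists R N0; have [oN o1 _ pr] := hom.
(* de^2 and eps regularize the logarithms of squared distances, on the circle
   and between the image points; they are negligible against the squared
   spacing of the nodes, at least N^-2, and their logarithms are O(ln N) *)
pose de : R := N%:R^-1 ^+ 2.
pose t := 1 - de.
have de0 : 0 < de by rewrite exprn_gt0 // invr_gt0.
have de1 : de <= 2^-1.
  have : N%:R^-1 <= 2^-1 :> R by rewrite lef_pV2 ?posrE // ler_nat ltnW.
  have : 0 < N%:R^-1 :> R by rewrite invr_gt0.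
  rewrite /de expr2; nra.
have deN : de <= N%:R^-1.
  by rewrite /de expr2 ger_pMr ?invr_gt0 // invf_le1.
pose eps : R := N%:R^-1 ^+ 3.
have eps0 : 0 < eps by rewrite exprn_gt0 // invr_gt0.
pose W k := node a om rho k.
have hW k : cball a r (W k) by apply: on_circle => //; exact: ltW.
pose P j k := cmod (diffquot f (g (W j)) (g (W k))).
have Pm j k : m <= P j k by exact: hP.
have P0 j k : 0 < P j k by exact: lt_le_trans (Pm j k).
have PM j k : P j k <= PB by exact: hPB.
pose F z := ln (cmod (1 - t%:C * z) ^+ 2).
pose A j k := ln (eps + cmod (g (W j) - g (W k)) ^+ 2).
pose B j k := F (om ^+ j * (om ^+ k)^*) + ln (rho ^+ 2) - ln (P j k ^+ 2).
have gW j k : cmod (g (W j) - g (W k)) * P j k = rho * cmod (1 - om ^+ j * (om ^+ k)^*).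
  rewrite /P -cmodM diffquotE !h.1; try exact: sub.
  have -> : W j - W k = rho%:C * (om ^+ k * (om ^+ j * (om ^+ k)^* - 1)).
    have -> : om ^+ k * (om ^+ j * (om ^+ k)^* - 1) =
      om ^+ j * ((om ^+ k)^* * om ^+ k) - om ^+ k by ring.
    by rewrite (root_conj k hom) /W /node; ring.
  by rewrite !cmodM cmodR cmodX o1 expr1n mul1r cmodC ger0_norm // ltW.
(* A is the energy kernel of the image points, B its model *)
have AB (j k : 'I_N) : `|A j k - B j k| <= K1 / N%:R + (j == k)%:R * (ln N%:R + K2).
  have [<-|jk] := eqVneq j k.
    apply: ler_wpDl; first by rewrite divr_ge0 // ltW.
    rewrite mul1r /A /B /F subrr cmod0 expr0n /= addr0 [om ^+ j * _]mulrC (root_conj j hom).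
    rewrite mulr1 /t rmorphB /= rmorph1 subKr cmodR (ger0_norm (ltW de0)).
    have iN : 0 < N%:R^-1 :> R by rewrite invr_gt0.
    have le1 : ln eps = - (3 * ln N%:R) by rewrite /eps lnXn // lnV ?posrE // -[_ *+ 3]mulr_natl mulrN.
    have le2 : ln (de ^+ 2) = - (4 * ln N%:R).
      by rewrite /de -exprM lnXn // lnV ?posrE // -[_ *+ _]mulr_natl mulrN.
    rewrite le1 le2.
    have b1 : ln (m ^+ 2) <= ln (P j j ^+ 2).
      by rewrite ler_ln ?posrE ?exprn_gt0 // ler_pXn2r ?nnegrE ?Pm // ltW.
    have b2 : ln (P j j ^+ 2) <= ln (PB ^+ 2).
      rewrite ler_ln ?posrE ?exprn_gt0 // ?(lt_le_trans (P0 j j)) //.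
      by rewrite ler_pXn2r ?nnegrE ?PM // ltW // (lt_le_trans (P0 j j)).
    have := ler_norm (ln (PB ^+ 2)); have := ler_norm (- ln (m ^+ 2)); rewrite normrN.
    have := ler_norm (ln (rho ^+ 2)); have := ler_norm (- ln (rho ^+ 2)); rewrite normrN.
    have := normr_ge0 (ln (PB ^+ 2)); have := normr_ge0 (ln (m ^+ 2)).
    rewrite ler_norml /K2; lra.
  rewrite mul0r addr0; set z := om ^+ j * (om ^+ k)^*.
  have z1 : cmod z = 1 by rewrite cmodM cmodJ !cmodX o1 !expr1n mulr1.
  have zn : z != 1.
    apply/eqP => e; have : om ^+ j = om ^+ k.
      rewrite -[LHS]mulr1 -(root_conj k hom) mulrA -/z e mul1r //.
    wlog lt : j k jk {z e z1} / (k < j)%N.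
      move=> wl e'; have [kj|jk'|/val_inj e2] := ltngtP k j.
      - exact: wl jk kj e'.
      - by apply: (wl k j _ jk' (esym e')); rewrite eq_sym.
      - by move: jk; rewrite e2 eqxx.
    move=> e'; have ok0 : om ^+ k != 0 by rewrite -cmod_eq0 cmodX o1 expr1n oner_eq0.
    have /negP := pr (j - k)%N (ltac:(rewrite subn_gt0 lt /=; exact: leq_ltn_trans (leq_subr _ _) (ltn_ord j))).
    apply; apply/eqP; apply: (mulIf ok0).
    by rewrite mul1r -exprD subnK // ltnW.
  have zN : z ^+ N = 1.
    by rewrite exprMn -rmorphXn /= ![(om ^+ _) ^+ N]exprAC oN !expr1n rmorph1 mulr1.
  have hQ := chord_lower N0 zN zn z1.
  set Q := cmod (1 - z) ^+ 2.
  have dQ : de <= Q by rewrite /de /Q ler_pXn2r ?nnegrE ?cmod_ge0 // invr_ge0 ltW.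
  have Q0 : 0 < Q by exact: lt_le_trans dQ.
  set X := cmod (g (W j) - g (W k)) ^+ 2.
  have XE : X * P j k ^+ 2 = rho ^+ 2 * Q by rewrite /X /Q -!exprMn gW.
  have P20 : 0 < P j k ^+ 2 by rewrite exprn_gt0.
  have r20 : 0 < rho ^+ 2 by rewrite exprn_gt0.
  have X0 : 0 < X by rewrite -(pmulr_lgt0 _ P20) XE mulr_gt0.
  have e1 := ln_regularize (ltW eps0) X0.
  have e2 : 0 <= ln Q - F z <= 2 * de.
    rewrite /F cmod_one_sub // -/Q.
    have -> : 1 - t = de by rewrite /t; ring.
    by apply: ln_contract => //; rewrite de0.
  have e3 : A j k - B j k = (ln (eps + X) - ln X) + (ln Q - F z).
    have : ln X + ln (P j k ^+ 2) = ln (rho ^+ 2) + ln Q.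
      by rewrite -[LHS]lnM ?posrE // -[RHS]lnM ?posrE // XE.
    by rewrite /A /B -/X -/z; lra.
  have e4 : eps / X <= PB ^+ 2 / rho ^+ 2 / N%:R.
    rewrite ler_pdivrMr //.
    have : rho ^+ 2 * de <= X * PB ^+ 2.
      apply: le_trans (_ : rho ^+ 2 * Q <= _); first by rewrite ler_pM2l.
      rewrite -XE ler_pM2l // ler_pXn2r ?nnegrE ?PM // ltW //.
      exact: lt_le_trans (P0 j k) (PM j k).
    have -> : PB ^+ 2 / rho ^+ 2 / N%:R * X = (X * PB ^+ 2) / (rho ^+ 2) / N%:R by ring.
    rewrite ler_pdivlMr // ler_pdivlMr // => le1; apply: le_trans le1.
    have epsN : eps * N%:R = de by rewrite /eps /de exprSr divfK ?gt_eqF.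
    by rewrite epsN mulrC.
  case/andP: e1 => e1 e1'; case/andP: e2 => e2 e2'.
  rewrite e3 (ger0_norm (addr_ge0 e1 e2)) /K1 [X in _ <= X]mulrDl; apply: lerD.
    exact: le_trans e1' e4.
  apply: le_trans e2' _; rewrite ler_pM2l //.
have SA : \sum_(k < N) \sum_(j < N) charge c om j * charge c om k * A j k <= 0.
  rewrite exchange_big /=.
  by apply: (@log_energy R N (fun j => g (W j)) (fun j => charge c om j)) => //; apply: charge_sum0 => //; exact: ltnW.
have SAB : \sum_(k < N) \sum_(j < N) charge c om j * charge c om k * B j k <=
  N%:R * (K1 + K2 + ln N%:R).
  rewrite -[X in X <= _]subr0; apply: le_trans (lerB (lexx _) SA) _.
  rewrite -sumrB.
  apply: le_trans (_ : \sum_(k < N) (K1 + K2 + ln N%:R) <= _); last first.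
    by rewrite sumr_const card_ord -[_ *+ N]mulr_natl.
  apply: ler_sum => k _; rewrite -sumrB.
  apply: le_trans (_ : \sum_(j < N) (K1 / N%:R + (j == k)%:R * (ln N%:R + K2)) <= _).
    apply: ler_sum => j _; rewrite -mulrBr; apply: le_trans (ler_norm _) _.
    rewrite normrM distrC -[X in _ <= X]mul1r ler_pM // normrM -[1]mulr1 ler_pM //; exact: charge_le1.
  rewrite big_split /= sumr_const card_ord -[_ *+ N]mulr_natr divfK ?gt_eqF //.
  rewrite (bigD1 k) //= eqxx mul1r big1 ?addr0; first by lra.
  by move=> j /negbTE ->; rewrite mul0r.
have SB : N%:R^-1 ^+ 2 * (\sum_(k < N) \sum_(j < N) charge c om j * charge c om k * B j k) =
   circle_energy N om t / 2 -
   N%:R^-1 ^+ 2 * (\sum_(k < N) \sum_(j < N) charge c om j * charge c om k * ln (P j k ^+ 2)).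
  have := charge_energy_circle F hom N2 c1 => eF.
  have -> : \sum_(k < N) \sum_(j < N) charge c om j * charge c om k * B j k =
     \sum_(k < N) \sum_(j < N) charge c om j * charge c om k * F (om ^+ j * (om ^+ k)^*)
     - \sum_(k < N) \sum_(j < N) charge c om j * charge c om k * ln (P j k ^+ 2).
    have z : \sum_(k < N) \sum_(j < N) charge c om j * charge c om k * ln (rho ^+ 2) = 0.
      rewrite big1 // => k _.
      rewrite (eq_bigr (fun j : 'I_N => charge c om j * (charge c om k * ln (rho ^+ 2)))).
        by rewrite -mulr_suml (charge_sum0 _ hom (ltnW N2)) mul0r.
      by move=> j _; rewrite mulrA.
    rewrite -[X in _ = X - _]addr0 -[X in _ = _ + X - _]z -big_split -sumrB /=.
    apply: eq_bigr => k _; rewrite -big_split -sumrB /=; apply: eq_bigr => j _.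
    by rewrite /B; ring.
  rewrite eF mulrBr; congr (_ - _); rewrite /circle_energy /F.
  by set T := \sum_(j < N) _; field; rewrite gt_eqF.
have hD : - 1 - 8 / N%:R * ln N%:R <= circle_energy N om t.
  have t0 : 0 <= t < 1 by rewrite /t; lra.
  move: (hom); rewrite NM => hom'.
  have := circle_energy_ge hom' M1 t0; rewrite -NM; apply: le_trans.
  have t1 : 1 - t <= 1 - t ^+ M.
    case/andP: t0 => t0 t1; rewrite lerD2l lerN2.
    by rewrite -[M]prednK ?(ltn_trans _ M1) // exprS ler_piMr // exprn_ile1 // ltW.
  have dt : 0 < 1 - t by rewrite /t; lra.
  have l1 : ln (1 - t) <= ln (1 - t ^+ M).
    by rewrite ler_ln ?posrE // (lt_le_trans dt).
  have l2 : ln (1 - t) = - (2 * ln N%:R).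
    rewrite (_ : 1 - t = de); last by rewrite /t; ring.
    by rewrite /de lnXn ?invr_gt0 // lnV ?posrE // mulr2n; ring.
  have l3 : 2 / M%:R * ln (1 - t) <= 2 / M%:R * ln (1 - t ^+ M).
    by rewrite ler_pM2l // divr_gt0.
  apply: le_trans (lerD (lexx (- t)) l3); rewrite l2.
  have -> : 8 / N%:R * ln N%:R = 2 / M%:R * (2 * ln N%:R) :> R.
    by rewrite NMR; field; rewrite gt_eqF.
  rewrite /t; lra.
have := HK N om c hom N2 c1; rewrite -/S c2.
have -> : complex.Re (- u * S) = - cmod S by rewrite mulNr uS.
rewrite ler_norml => /andP[_ hK].
have h1 : N%:R^-1 ^+ 2 * (\sum_(k < N) \sum_(j < N) charge c om j * charge c om k * B j k)
   <= (K1 + K2 + ln N%:R) / N%:R.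
  apply: le_trans (_ : N%:R^-1 ^+ 2 * (N%:R * (K1 + K2 + ln N%:R)) <= _).
    by rewrite ler_pM2l // exprn_gt0 // invr_gt0.
  by rewrite le_eqVlt; apply/orP; left; apply/eqP; field; rewrite gt_eqF.
move: h1; rewrite SB => h1.
have e8 : 8 / N%:R * ln N%:R = 2 * (4 * ln N%:R / N%:R) :> R by field; rewrite gt_eqF.
rewrite e8 in hD.
have -> : (K1 + K2 + K + 5 * ln N%:R) / N%:R =
  (K1 + K2 + ln N%:R) / N%:R + K / N%:R + 4 * ln N%:R / N%:R by ring.
move: hK h1 hD; rewrite /P /W.
set Z := N%:R^-1 ^+ 2 * _; lra.
Qed.

End SchwarzianBoundProof.

(** * The pre-Schwarzian bound *)

Section PreSchwarzian.
Variable R : realType.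
Implicit Types (f : {poly R[i]}) (g : R[i] -> R[i]) (a w z : R[i]) (d r e : R).

(** With x = g w this is -g''/g' at w. *)
Definition preschwarz f x : R[i] := f^`()^`().[x] / f^`().[x] ^+ 2.

(** The Riccati equation Y' = Y^2/2 + S satisfied by Y = g''/g'. *)
Lemma preschwarz_deriv f a d g w : disc_branch f a d g -> cball a d w ->
  cderiv (fun z => preschwarz f (g z)) w
    (6 * schwarz f (g w) - preschwarz f (g w) ^+ 2 / 2).
Proof.
move=> h hw; have [n0 dg] := branch_deriv h hw.
have d2 := cderiv_comp dg (cderiv_horner f^`()^`() (g w)).
have d1 := cderiv_comp dg (cderiv_horner f^`() (g w)).
have n2 : f^`().[g w] * f^`().[g w] != 0 by rewrite mulf_neq0.
have d3 := cderivM d2 (@cderivV R (fun z => f^`().[g z] * f^`().[g z]) w _ n2 (cderivM d1 d1)).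
have -> : (fun z => preschwarz f (g z)) =
   fun z => f^`()^`().[g z] * (f^`().[g z] * f^`().[g z])^-1.
  by apply/funext => z; rewrite /preschwarz expr2.
by apply: cderivE d3 _; rewrite /preschwarz /schwarz; field; rewrite n0.
Qed.

(** Moving by s in the direction of growth of |Y| multiplies e by at least
1 - s/e and |Y| by about 1 + s |D| / |Y|; the product cannot increase. *)
Lemma slope_at_weighted_max (Y : R[i] -> R[i]) w (D : R[i]) e : 0 < e ->
  cderiv Y w D ->
  (forall z, cmod (z - w) < e -> (e - cmod (z - w)) * cmod (Y z) <= e * cmod (Y w)) ->
  e * cmod D <= cmod (Y w).
Proof.
move=> e0 dY hmax; rewrite leNgt; apply/negP => lt.
set k := e * cmod D - cmod (Y w); have k0 : 0 < k by rewrite subr_gt0.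
have [u u1 uY] := unit_align (Y w); have [v v1 vD] := unit_align D.
have et0 : 0 < k / (4 * e) by rewrite divr_gt0 // mulr_gt0.
have [dl dl0 H] := cderiv_approx dY et0.
have D1 : 0 < 4 * (cmod D + 1) by rewrite mulr_gt0 // ltr_wpDl // cmod_ge0.
pose s := Num.min (Num.min (dl / 2) (e / 2)) (k / (4 * (cmod D + 1))).
have s0 : 0 < s by rewrite !lt_min !divr_gt0.
have sdl : s <= dl / 2 by rewrite /s !ge_min lexx.
have se : s <= e / 2 by rewrite /s !ge_min lexx orbT.
have sk : s <= k / (4 * (cmod D + 1)) by rewrite /s !ge_min lexx !orbT.
have un0 : u != 0 by rewrite -cmod_eq0 u1 oner_eq0.
(* v turns D, and u turns Y w, onto the positive axis, so v / u makes the first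
   order increment of Y parallel to Y w *)
pose z := w + s%:C * (v / u).
have zw : z - w = s%:C * (v / u) by rewrite /z addrAC subrr add0r.
have mz : cmod (z - w) = s.
  by rewrite zw !cmodM cmodV u1 v1 invr1 !mulr1 cmodR ger0_norm // ltW.
have := H z; rewrite mz => h1.
have {}h1 : cmod (Y z - Y w - D * (z - w)) <= k / (4 * e) * s by apply: h1; lra.
have h2 : cmod (Y w + D * (z - w)) = cmod (Y w) + s * cmod D.
  rewrite -[LHS]mul1r -u1 -cmodM.
  have -> : u * (Y w + D * (z - w)) = (cmod (Y w) + s * cmod D)%:C.
    rewrite rmorphD rmorphM /= -uY -vD zw; field.
    by rewrite un0.
  by rewrite cmodR ger0_norm // addr_ge0 ?mulr_ge0 ?cmod_ge0 // ltW.
have h3 : cmod (Y w) + s * cmod D - k / (4 * e) * s <= cmod (Y z).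
  have := cmod_ge (Y w + D * (z - w)) (- (Y w + D * (z - w) - Y z)).
  have -> : Y w + D * (z - w) + - (Y w + D * (z - w) - Y z) = Y z by ring.
  rewrite h2 cmodN.
  have -> : Y w + D * (z - w) - Y z = - (Y z - Y w - D * (z - w)) by ring.
  by rewrite cmodN; lra.
have h4 : (e - s) * cmod (Y z) <= e * cmod (Y w) by rewrite -mz; apply: hmax; rewrite mz; lra.
have h5 : (e - s) * (cmod (Y w) + s * cmod D - k / (4 * e) * s) <= e * cmod (Y w).
  by apply: le_trans h4; rewrite ler_pM2l //; lra.
have h6 : s * (k - s * cmod D - k / 4 + s * (k / (4 * e))) <= 0.
  have -> : s * (k - s * cmod D - k / 4 + s * (k / (4 * e))) =
    (e - s) * (cmod (Y w) + s * cmod D - k / (4 * e) * s) - e * cmod (Y w).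
    by rewrite /k; field; rewrite gt_eqF.
  by rewrite subr_le0.
move: h6; rewrite pmulr_rle0 // => h6.
have h7 : s * cmod D <= k / 4.
  have : s * (4 * (cmod D + 1)) <= k by rewrite -ler_pdivlMr.
  lra.
have h8 : 0 < s * (k / (4 * e)) by rewrite mulr_gt0.
lra.
Qed.

(** The constant 4.61 exceeds the positive root 1 + sqrt 13 of m^2 = 2 m + 12. *)
Lemma preschwarz_at_max f w d g e : 0 < e < d -> disc_branch f w d g ->
  (forall z, cmod (z - w) < e -> (e - cmod (z - w)) * cmod (preschwarz f (g z))
     <= e * cmod (preschwarz f (g w))) ->
  e * cmod (preschwarz f (g w)) <= 461 / 100.
Proof.
move=> /[dup] eI /andP[e0 ed] h hmax.
have hw : cball w d w by rewrite /cball subrr cmod0; lra.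
have dY := preschwarz_deriv h hw.
have h1 := slope_at_weighted_max e0 dY hmax.
have h2 := schwarz_bound eI h.
set Y := preschwarz f (g w) in h1 *; set S := schwarz f (g w) in h1 h2.
have h3 : cmod Y ^+ 2 / 2 <= cmod (6 * S - Y ^+ 2 / 2) + 6 * cmod S.
  have -> : cmod Y ^+ 2 / 2 = cmod (Y ^+ 2 / 2) by rewrite cmodM cmodX cmodV cmod_nat.
  have -> : 6 * cmod S = cmod (6 * S) by rewrite cmodM cmod_nat.
  have {1}-> : Y ^+ 2 / 2 = - (6 * S - Y ^+ 2 / 2) + 6 * S by ring.
  by apply: le_trans (cmodD _ _) _; rewrite cmodN.
set m := e * cmod Y.
have m0 : 0 <= m by rewrite mulr_ge0 ?cmod_ge0 // ltW.
have h4 : m ^+ 2 <= 2 * m + 12.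
  have : e ^+ 2 * (cmod Y ^+ 2 / 2) <= e ^+ 2 * (cmod (6 * S - Y ^+ 2 / 2) + 6 * cmod S).
    by rewrite ler_pM2l // exprn_gt0.
  have : e * (e * cmod (6 * S - Y ^+ 2 / 2)) <= e * cmod Y by rewrite ler_pM2l.
  rewrite /m exprMn; lra.
rewrite leNgt; apply/negP => m1; nra.
Qed.

(** The weight r - |w - a| vanishes on the circle of radius r, so its product with
|Y| attains its maximum over the closed disc inside, unless Y vanishes there. *)
Lemma preschwarz_bound f a d g : 0 < d -> disc_branch f a d g ->
  d * cmod (preschwarz f (g a)) <= 461 / 100.
Proof.
move=> d0 h.
have inner (r : R) : 0 <= r < d -> r * cmod (preschwarz f (g a)) <= 461 / 100.
  move=> /andP[r0 rd].
  have [|w wr wmax] := @disc_max R (fun w => (r - cmod (w - a)) * cmod (preschwarz f (g w))) a r r0.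
    move=> w wr; apply: rcontM; first exact: rcont_gap.
    have hw : cball a d w by exact: le_lt_trans rd.
    exact: rcont_cmod (cderiv_ccont (preschwarz_deriv h hw)).
  have := wmax a; rewrite subrr cmod0 subr0 => /(_ r0) la.
  apply: le_trans la _.
  have [e0|e0] := leP (r - cmod (w - a)) 0.
    apply: le_trans (_ : 0 <= _); last by lra.
    exact: mulr_le0_ge0 (cmod_ge0 _).
  have hs : disc_branch f w (d - cmod (w - a)) g.
    by apply: disc_branch_sub h; lra.
  apply: (preschwarz_at_max (d := d - cmod (w - a)) _ hs).
    by rewrite e0 /=; lra.
  move=> z hz; have ht := cmod_tri z a w.
  apply: le_trans (_ : (r - cmod (z - a)) * cmod (preschwarz f (g z)) <= _).
    by rewrite ler_wpM2r ?cmod_ge0 //; lra.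
  by apply: wmax; lra.
rewrite leNgt; apply/negP => lt.
set y := cmod _ in inner lt.
have y0 : 0 < y.
  by rewrite lt_neqAle cmod_ge0 andbT eq_sym; apply/eqP => y0; move: lt; rewrite y0; lra.
have ly : 461 / 100 / y < d by rewrite ltr_pdivrMr.
have p0 : 0 < 461 / 100 / y by apply: divr_gt0 _ y0; apply: divr_gt0; rewrite ltr0n.
have := inner ((d + 461 / 100 / y) / 2).
have -> : (d + 461 / 100 / y) / 2 * y = (d * y + 461 / 100) / 2 by field; rewrite gt_eqF.
set q := 461 / 100 / y in ly p0 *.
have hI : 0 <= (d + q) / 2 < d by apply/andP; split; lra.
by move=> /(_ hI); lra.
Qed.

End PreSchwarzian.

(** * One Newton step *)

Section NewtonStep.
Variable R : realType.
Implicit Types (f : {poly R[i]}) (g : R[i] -> R[i]) (w z : R[i]).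

Lemma real_induction (P : R -> Prop) :
  (forall t, 0 <= t <= 1 -> (forall s, 0 <= s < t -> P s) -> P t) ->
  (forall t, 0 <= t < 1 -> (forall s, 0 <= s <= t -> P s) ->
     exists2 dl : R, 0 < dl & forall s, t <= s < t + dl -> P s) ->
  forall t, 0 <= t <= 1 -> P t.
Proof.
move=> Hc Ho.
pose S := [set t | 0 <= t <= 1 /\ forall s, 0 <= s <= t -> P s].
have P0 : P 0.
  by apply: Hc => [|s /andP[s0 s1]]; [rewrite lexx ler01 | have := le_lt_trans s0 s1; rewrite ltxx].
have S0 : S 0.
  split; first by rewrite lexx ler01.
  by move=> s s0; have -> : s = 0 by apply/eqP; rewrite eq_le andbC.
have ub1 : ubound S 1 by move=> t [/andP[]].
have hs : has_sup S by split; [exists 0 | exists 1].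
set tau := sup S.
have tau0 : 0 <= tau by exact: (sup_upper_bound hs).
have tau1 : tau <= 1 by apply: ge_sup => //; exists 0.
have below s : 0 <= s < tau -> P s.
  move=> /andP[s0 st].
  have [t [tI tP] lt] := sup_adherent (eps := tau - s) (ltac:(by rewrite subr_gt0)) hs.
  apply: tP; rewrite s0 ltW //; move: lt; rewrite -/tau; lra.
have Pt : P tau by apply: Hc => //; rewrite tau0.
have upto s : 0 <= s <= tau -> P s.
  move=> /andP[s0]; rewrite le_eqVlt => /orP[/eqP -> //|st].
  by apply: below; rewrite s0.
have [lt1|ge1] := ltP tau 1; last first.
  by move=> t /andP[t0 t1]; apply: upto; rewrite t0 (le_trans t1).
have [dl dl0 H] := Ho tau (ltac:(by rewrite tau0)) upto.
pose t' := Num.min 1 (tau + dl / 2).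
have t'1 : t' <= 1 by rewrite ge_min lexx.
have t'2 : t' <= tau + dl / 2 by rewrite ge_min lexx orbT.
have t'3 : tau < t' by rewrite lt_min lt1 ltrDl divr_gt0.
have : t' <= tau.
  apply: (sup_upper_bound hs); split; first by rewrite t'1 andbT; lra.
  move=> s /andP[s0 st]; have [le|gt] := leP s tau; first by apply: upto; rewrite s0.
  by apply: H; apply/andP; split; lra.
by rewrite leNgt t'3.
Qed.

Lemma ccont_path (F : R[i] -> R[i]) (t : R) : ccont F t%:C ->
  forall e : R, 0 < e -> exists2 dl : R, 0 < dl &
    forall s : R, `|s - t| < dl -> cmod (F s%:C - F t%:C) < e.
Proof.
move=> h e e0; have [dl dl0 H] := h e e0; exists dl => // s hs.
by apply: H; rewrite -rmorphB cmodR.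
Qed.

Lemma locally_injective f z : f^`().[z] != 0 ->
  exists2 r : R, 0 < r & forall x y, cball z r x -> cball z r y -> f.[x] = f.[y] -> x = y.
Proof.
move=> n0; have k0 : 0 < cmod f^`().[z] / 2 by rewrite divr_gt0 // cmod_gt0.
have [r r0 H] := cderiv_ccont (cderiv_horner f^`() z) k0; exists r => // x y hx hy e.
have := @mean_value_ineq R (fun u => f.[u] - f^`().[z] * u)
  (fun u => f^`().[u] - f^`().[z]) z y x r (cmod f^`().[z] / 2).
have d1 u : cball z r u -> cderiv (fun u => f.[u] - f^`().[z] * u) u (f^`().[u] - f^`().[z]).
  move=> _; apply: cderivE (cderivB (cderiv_horner f u) (cderivM (cderiv_cst _ u) (cderiv_id u))) _.
  by rewrite mul0r add0r mulr1.
have d2 u : cball z r u -> cmod (f^`().[u] - f^`().[z]) <= cmod f^`().[z] / 2.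
  by move=> hu; apply/ltW/H.
move=> /(_ d1 d2 hy hx).
have -> : f.[x] - f^`().[z] * x - (f.[y] - f^`().[z] * y) = - (f^`().[z] * (x - y)).
  by rewrite e; ring.
rewrite cmodN cmodM => le1; apply/eqP; rewrite -subr_eq0 -cmod_eq0.
have m0 : 0 < cmod f^`().[z] by rewrite cmod_gt0.
have : cmod f^`().[z] * cmod (x - y) <= 0 by lra.
by rewrite pmulr_rle0 // => le2; rewrite eq_le le2 cmod_ge0.
Qed.

(** With x = 0.42 t, the hypotheses give E <= (3/2) H x / (1 - x); the bound comes
from x / (1 - x) = x + x^2 + x^3 / (1 - x) with the last term estimated for
x <= 0.42. *)
Lemma rate_deviation_bound (H t E u d q r : R) : 0 < H -> 0 <= t <= 1 ->
  0 <= E -> 0 <= u -> 0 <= d -> 0 < q -> u <= 3 / 2 * H -> d <= 21 / 50 * t * q ->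
  q - d <= r -> E * r = u * d ->
  E <= H * (63 / 100 * t + 1323 / 5000 * t ^+ 2 + 1 / 5 * t ^+ 3).
Proof.
move=> H0 /andP[t0 t1] E0 u0 d0 q0 uH dq qr Er.
have h1 : E * (q * (1 - 21 / 50 * t)) <= 3 / 2 * H * (21 / 50 * t * q).
  apply: le_trans (_ : E * r <= _); last by rewrite Er ler_pM.
  by rewrite ler_wpM2l //; move: dq qr; clear; lra.
have h2 : E * (1 - 21 / 50 * t) <= 63 / 100 * H * t.
  by rewrite -(ler_pM2r q0); move: h1; clear; lra.
have x1 : 0 < 1 - 21 / 50 * t by move: t1; clear; lra.
rewrite -(ler_pM2r x1); apply: le_trans h2 _.
set x := 21 / 50 * t in x1 *.
have t3 : 0 <= t ^+ 3 by rewrite exprn_ge0.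
have x3 : x ^+ 3 <= 189 / 2500 * t ^+ 3.
  have -> : x ^+ 3 = 21 / 50 * (441 / 2500 * t ^+ 3) by rewrite /x; field.
  by move: t3; clear; lra.
have h3 : 0 <= t ^+ 3 * (21 / 50 - x).
  by rewrite mulr_ge0 // /x; move: t1; clear; lra.
have h4 : 0 <= H * (1 / 5 * t ^+ 3 * (1 - x) - 3 / 2 * x ^+ 3).
  by rewrite mulr_ge0 ?(ltW H0) //; move: h3 x3 t3; clear; lra.
have -> : H * (63 / 100 * t + 1323 / 5000 * t ^+ 2 + 1 / 5 * t ^+ 3) * (1 - x) =
  63 / 100 * H * t + H * (1 / 5 * t ^+ 3 * (1 - x) - 3 / 2 * x ^+ 3).
  by rewrite /x; field.
by rewrite lerDl.
Qed.

(** While f stays in the disc of radius 2 H about zeta along the segment from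
z = g zeta to the new point, the bound on f''/f'^2 keeps 1/f' close to its initial
value, hence f close to its linearization. The deviation is too small for f to
leave the disc, and by continuity the segment is the image under g of its image
under f. *)
Lemma newton_step f g zeta w1 (H : R) : 0 < H ->
  disc_branch f zeta (37 / 2 * H) g -> cmod (w1 - zeta) <= 3 / 2 * H ->
  let z' := g zeta - (zeta - w1) / f^`().[g zeta] in
  [/\ g f.[z'] = z', cmod (f.[z'] - zeta) <= 2 * H &
      cmod (f.[z'] - w1) <= 46 / 100 * H].
Proof.
move=> H0 h hw z'.
have hz : cball zeta (37 / 2 * H) zeta by rewrite /cball subrr cmod0; lra.
have [n0 _] := branch_deriv h hz.
set z := g zeta in z' n0 *; set u0 := w1 - zeta in hw *.
have fz : f.[z] = zeta by exact: h.1.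
pose dz := u0 / f^`().[z].
pose Z (t : R) := z + t%:C * dz.
have Z1 : Z 1 = z' by rewrite /Z rmorph1 mul1r /z' /dz /u0 -[zeta - w1]opprB mulNr opprK.
have Z0 : Z 0 = z by rewrite /Z mul0r addr0.
have in2 w : cmod (w - zeta) < 2 * H -> cball zeta (37 / 2 * H) w.
  by rewrite /cball; lra.
(* 33/2 = 37/2 - 2, and 7/25 > 4.61 / (33/2) *)
have hY w : cmod (w - zeta) < 2 * H -> cmod (preschwarz f (g w)) <= 7 / 25 / H.
  move=> hw2; have hs : disc_branch f w (33 / 2 * H) g by apply: disc_branch_sub h; lra.
  have p : 0 < 33 / 2 * H by lra.
  by rewrite ler_pdivlMr //; have := preschwarz_bound p hs; lra.
pose good (t : R) := g f.[Z t] = Z t /\ cmod (f.[Z t] - zeta) < 2 * H.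
have lin (t : R) : cderiv (fun s => z + s * dz) t%:C dz.
  apply: cderivE (cderivD (cderiv_cst _ _) (cderivM (cderiv_id _) (cderiv_cst _ _))) _.
  by rewrite mul1r mulr0 addr0 add0r.
have good_deriv (t : R) : good t -> f^`().[Z t] != 0.
  by move=> [e hg]; have [] := branch_deriv h (in2 _ hg); rewrite e.
have est (T : R) : 0 <= T <= 1 -> (forall s, 0 <= s <= T -> good s) ->
    cmod (f.[Z T] - zeta - T%:C * u0) <= 46 / 100 * H.
  move=> /andP[T0 T1] hg.
  have th (s : R) : 0 <= s <= T ->
      cmod (f^`().[Z s]^-1 - f^`().[z]^-1) <= 7 / 25 / H * cmod dz * s.
    move=> /andP[s0 sT].
    have := @path_variation R (fun w => f^`().[w]^-1)
      (fun t => - preschwarz f (Z t)) (fun t => 7 / 25 / H * cmod dz * t)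
      (fun=> 7 / 25 / H * cmod dz) z dz s s0.
    rewrite mulr0 subr0; apply.
    - move=> t /andP[t0 ts]; have tI : 0 <= t <= T by rewrite t0 (le_trans ts).
      apply: cderivE (cderivV (good_deriv t (hg t tI)) (cderiv_horner f^`() (Z t))) _.
      by rewrite /preschwarz mulNr.
    - by move=> t _; exact: rderiv_lin.
    - move=> t /andP[t0 ts]; have tI : 0 <= t <= T by rewrite t0 (le_trans ts).
      rewrite cmodM cmodN ler_wpM2r ?cmod_ge0 //.
      by have [e hg2] := hg t tI; rewrite -e; exact: hY.
  have := @path_variation R (fun w => f.[z + w * dz] - w * u0)
     (fun t => f^`().[Z t] * dz - u0)
     (fun t => 63 / 200 * H * t ^+ 2 + 441 / 5000 * H * t ^+ 3 + 1 / 20 * H * t ^+ 4)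
     (fun t => H * (63 / 100 * t + 1323 / 5000 * t ^+ 2 + 1 / 5 * t ^+ 3)) 0 1 T T0.
  rewrite mulr1 add0r !mul0r addr0 subr0 fz.
  have -> : f.[z + T%:C * dz] - T%:C * u0 - zeta = f.[Z T] - zeta - T%:C * u0.
    by rewrite /Z; ring.
  rewrite !expr0n /= !mulr0 !addr0 subr0 => hv; apply: le_trans (hv _ _ _) _.
  - move=> t /andP[t0 tT]; rewrite mulr1 add0r.
    apply: cderivE (cderivB (@cderiv_comp R (horner f) (fun s => z + s * dz) _ _ _ (lin t)
      (cderiv_horner f (Z t))) (cderivM (cderiv_id _) (cderiv_cst _ _))) _.
    by rewrite mul1r mulr0 addr0.
  - move=> t _; apply: rderivE (rderivD (rderivD (rderivZ _ (rderivX 2 (rderiv_id t)))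
      (rderivZ _ (rderivX 3 (rderiv_id t)))) (rderivZ _ (rderivX 4 (rderiv_id t)))) _.
    by rewrite /=; field.
  - move=> t tI; have := th t tI; case/andP: (tI) => t0 tT; rewrite mulr1.
    have nt := good_deriv t (hg t tI).
    set th0 := f^`().[z]^-1; set th1 := f^`().[Z t]^-1.
    have q0 : 0 < cmod th0 by rewrite cmod_gt0 invr_eq0.
    have e1 : (f^`().[Z t] * dz - u0) * th1 = u0 * (th0 - th1).
      by rewrite /dz /th0 /th1; field; rewrite n0 nt.
    have dzE : cmod dz = cmod u0 * cmod th0 by rewrite /dz cmodM.
    rewrite dzE => hth.
    set E := f^`().[Z t] * dz - u0 in e1 *.
    have e2 : cmod E * cmod th1 = cmod u0 * cmod (th0 - th1) by rewrite -!cmodM e1.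
    have X1 : 7 / 25 / H * cmod u0 <= 21 / 50.
      by rewrite mulrAC ler_pdivrMr //; move: hw; clear; lra.
    have t1 : t <= 1 by exact: le_trans T1.
    have hx : cmod (th0 - th1) <= 21 / 50 * t * cmod th0.
      rewrite cmodC; apply: le_trans hth _.
      have -> : 7 / 25 / H * (cmod u0 * cmod th0) * t = 7 / 25 / H * cmod u0 * (t * cmod th0) by ring.
      by rewrite -[X in _ <= X]mulrA ler_wpM2r // mulr_ge0 ?cmod_ge0.
    have low : cmod th0 - cmod (th0 - th1) <= cmod th1.
      have := cmod_ge th0 (th1 - th0); have -> : th0 + (th1 - th0) = th1 by ring.
      by rewrite [cmod (th1 - th0)]cmodC.
    by apply: (@rate_deviation_bound H t (cmod E) (cmod u0) (cmod (th0 - th1)) (cmod th0)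
      (cmod th1)); rewrite ?cmod_ge0 ?t0.
  have p2 : T ^+ 2 <= 1 by rewrite exprn_ile1.
  have p3 : T ^+ 3 <= 1 by rewrite exprn_ile1.
  have p4 : T ^+ 4 <= 1 by rewrite exprn_ile1.
  have : H * T ^+ 2 <= H by rewrite ler_piMr // ltW.
  have : H * T ^+ 3 <= H by rewrite ler_piMr // ltW.
  have : H * T ^+ 4 <= H by rewrite ler_piMr // ltW.
  move: H0; clear; lra.
have est2 (T : R) : 0 <= T <= 1 -> (forall s, 0 <= s <= T -> good s) ->
    cmod (f.[Z T] - zeta) <= 196 / 100 * H.
  move=> TI hg; have h1 := est T TI hg; case/andP: TI => T0 T1.
  have -> : f.[Z T] - zeta = (f.[Z T] - zeta - T%:C * u0) + T%:C * u0 by ring.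
  apply: le_trans (cmodD _ _) _; rewrite [cmod (T%:C * _)]cmodM cmodR ger0_norm //.
  have : T * cmod u0 <= cmod u0 by rewrite ler_piMl ?cmod_ge0.
  lra.
have cF (t : R) : ccont (fun s => f.[z + s * dz]) t%:C.
  exact: cderiv_ccont (@cderiv_comp R (horner f) _ _ _ _ (lin t) (cderiv_horner f (Z t))).
have cG (t : R) : cmod (f.[Z t] - zeta) < 2 * H -> ccont (fun s => g f.[z + s * dz]) t%:C.
  move=> ht; have [_ dg] := branch_deriv h (in2 _ ht).
  exact: cderiv_ccont (@cderiv_comp R g _ _ _ _
    (@cderiv_comp R (horner f) _ _ _ _ (lin t) (cderiv_horner f (Z t))) dg).
have cZ (t : R) : ccont (fun s => z + s * dz) t%:C by exact: cderiv_ccont (lin t).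
have all_good : forall t : R, 0 <= t <= 1 -> good t.
  apply: real_induction => t /andP[t0 t1] hg.
  - have [t00|tn0] := eqVneq t 0.
      by rewrite t00; split; rewrite Z0 fz // subrr cmod0; lra.
    have tp : 0 < t by rewrite lt_neqAle eq_sym tn0.
    have near (e : R) : 0 < e -> exists2 s : R, 0 <= s < t & `|s - t| < e.
      move=> e0; exists (t - Num.min t (e / 2)).
        rewrite subr_ge0 ge_min lexx /= ltrBlDr ltrDl lt_min tp divr_gt0 //.
      rewrite addrAC subrr add0r normrN ger0_norm; last by rewrite le_min t0 divr_ge0 // ltW.
      by rewrite gt_min; apply/orP; right; lra.
    have est3 s : 0 <= s < t -> cmod (f.[Z s] - zeta) <= 196 / 100 * H.
      move=> /andP[s0 st]; apply: est2; first by rewrite s0 (le_trans (ltW st)).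
      by move=> s' /andP[s'0 s's]; apply: hg; rewrite s'0 (le_lt_trans s's).
    have ht : cmod (f.[Z t] - zeta) < 2 * H.
      have e0 : 0 < 1 / 100 * H by lra.
      have [dl dl0 Hd] := ccont_path (cF t) e0.
      have [s sI /Hd] := near _ dl0; have := est3 s sI; rewrite -/(Z s) -/(Z t).
      have := cmod_tri f.[Z t] zeta f.[Z s]; rewrite [cmod (f.[Z t] - f.[Z s])]cmodC; lra.
    split => //; apply/eqP; rewrite -subr_eq0 -cmod_eq0 eq_le cmod_ge0 andbT.
    rewrite leNgt; apply/negP => e0.
    set e := cmod _ in e0.
    have e20 : 0 < e / 2 by rewrite divr_gt0.
    have [d1 d10 H1] := ccont_path (cG t ht) e20.
    have [d2 d20 H2] := ccont_path (cZ t) e20.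
    have [s sI] := near (Num.min d1 d2) (ltac:(by rewrite lt_min d10)).
    rewrite lt_min => /andP[/H1 + /H2]; have [es _] := hg s sI.
    rewrite -/(Z s) -/(Z t) es => h1 h2.
    have := cmod_tri (g f.[Z t]) (Z t) (Z s); rewrite -/e [cmod (g _ - Z s)]cmodC; lra.
  - have [et ht] := hg t (ltac:(by rewrite t0 lexx)).
    have [r r0 inj] := locally_injective (good_deriv t (conj et ht)).
    have gap : 0 < 2 * H - cmod (f.[Z t] - zeta) by lra.
    have [d1 d10 H1] := ccont_path (cG t ht) r0.
    have [d2 d20 H2] := ccont_path (cZ t) r0.
    have [d3 d30 H3] := ccont_path (cF t) gap.
    exists (Num.min (Num.min d1 d2) d3); first by rewrite !lt_min d10 d20.
    move=> s /andP[ts]; rewrite -ltrBlDl => sd.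
    have : `|s - t| < Num.min (Num.min d1 d2) d3 by rewrite ger0_norm // subr_ge0.
    rewrite !lt_min => /andP[/andP[/H1 h1 /H2 h2] /H3].
    rewrite -/(Z s) -/(Z t) => h3.
    have hs : cmod (f.[Z s] - zeta) < 2 * H.
      have := cmod_tri f.[Z s] zeta f.[Z t]; lra.
    split => //; apply: inj.
    + by rewrite /cball -{1}et.
    + exact: h2.
    + by rewrite h.1 //; exact: in2.
have g1 : good 1 by apply: all_good; rewrite ler01 lexx.
have one : (0 : R) <= (1 : R) <= (1 : R) by rewrite ler01 /=.
have upto (s : R) : 0 <= s <= 1 -> good s by exact: all_good.
rewrite -Z1; split; first by case: g1.
  by apply: le_trans (est2 1 one upto) _; lra.
have := est 1 one upto; rewrite rmorph1 mul1r /u0.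
by have -> : f.[Z 1] - zeta - (w1 - zeta) = f.[Z 1] - w1 by ring.
Qed.

End NewtonStep.

(** * Discs and wedges *)

Section Wedge.
Variable R : realType.
Implicit Types (w z : R[i]) (A a t : R).

Definition cis (t : R) : R[i] := cos t +i* sin t.

Lemma cisD a t : cis (a + t) = cis a * cis t.
Proof.
rewrite /cis cosD sinD; apply/eqP; rewrite eq_complex /=.
by apply/andP; split; apply/eqP; ring.
Qed.

Lemma is_argE z t : is_arg z t <-> z = (cmod z)%:C * cis t.
Proof. by rewrite /is_arg cmodE. Qed.

Lemma normalize z : z != 0 -> exists2 v, cmod v = 1 & z = (cmod z)%:C * v.
Proof.
move=> z0; have m0 : cmod z != 0 by rewrite cmod_eq0.
have mC : (cmod z)%:C != 0 :> R[i] by rewrite (inj_eq (@complexI R)).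
exists (z / (cmod z)%:C); last by rewrite mulrC divfK.
by rewrite cmodM cmodV cmodR ger0_norm ?cmod_ge0 // divff.
Qed.

Lemma is_arg_exists w : w != 0 -> exists a, is_arg w a.
Proof.
move=> w0; have [v v1 ->] := normalize w0.
have m0 := cmod_ge0 w.
have sq : complex.Re v ^+ 2 + complex.Im v ^+ 2 = 1 by rewrite -cmod_sqr v1 expr1n.
have xI : -1 <= complex.Re v <= 1.
  by have := sqr_ge0 (complex.Im v); move: sq; case: v {v1} => x y /= h1 h2; apply/andP; split; nra.
have sE : sin (acos (complex.Re v)) = `|complex.Im v|.
  rewrite sin_acos // -[RHS]sqrtr_sqr; congr Num.sqrt; lra.
have cE := acosK xI.
exists (if 0 <= complex.Im v then acos (complex.Re v) else - acos (complex.Re v)).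
apply/is_argE; rewrite cmodM v1 cmodR ger0_norm // mulr1; congr (_ * _).
rewrite /cis; have [y0|y0] := leP 0 (complex.Im v).
  by rewrite sE cE ger0_norm //; case: v {v1 sq xI sE cE y0}.
by rewrite cosN sinN sE cE ltr0_norm // opprK; case: v {v1 sq xI sE cE y0}.
Qed.

(** For s = sin A: the argument of x + i y has sine y / |x + i y|. The difference
of the two sides is a product of nonnegative factors plus a square. *)
Lemma disc_in_sector (x y s : R) : 0 < s <= 1 -> (x - 1) ^+ 2 + y ^+ 2 < s ^+ 2 ->
  0 < x /\ y ^+ 2 < s ^+ 2 * (x ^+ 2 + y ^+ 2).
Proof.
move=> /andP[s0 s1] h; have x0 : 0 < x by have := sqr_ge0 y; nra.
split => //; rewrite -subr_gt0.
have -> : s ^+ 2 * (x ^+ 2 + y ^+ 2) - y ^+ 2 =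
  (s ^+ 2 - ((x - 1) ^+ 2 + y ^+ 2)) * (1 - s ^+ 2) + (x - 1 + s ^+ 2) ^+ 2 by ring.
have [->|sn1] := eqVneq s 1.
  by rewrite expr1n subrr mulr0 add0r subrK exprn_gt0.
rewrite ltr_pwDl ?sqr_ge0 // mulr_gt0 // subr_gt0 // exprn_ilt1 ?ltW //.
by rewrite lt_neqAle sn1.
Qed.

(** The argument of z is that of w plus asin (Im v), where v is z/w normalized. *)
Lemma disc_in_wedge A w z : 0 < A <= pi / 2 -> cmod (z - w) < sin A * cmod w ->
  wedge A w z.
Proof.
move=> /andP[A0 A1] hz.
have pi0 : 0 < pi :> R by exact: pi_gt0.
have sA0 : 0 < sin A by apply: sin_gt0_pi; rewrite A0 /=; lra.
have sA1 : sin A <= 1 by exact: sin_le1.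
have mw : 0 < cmod w.
  by rewrite -(pmulr_rgt0 _ sA0) (le_lt_trans _ hz) // cmod_ge0.
have w0 : w != 0 by rewrite -cmod_gt0.
have wC : (cmod w)%:C != 0 :> R[i] by rewrite (inj_eq (@complexI R)) gt_eqF.
pose q := z / w; have zq : z = q * w by rewrite divfK.
have hq : cmod (q - 1) < sin A.
  rewrite -(ltr_pM2r mw) -cmodM; apply: le_lt_trans hz.
  by rewrite zq mulrBl mul1r.
have hq2 : (complex.Re q - 1) ^+ 2 + complex.Im q ^+ 2 < sin A ^+ 2.
  have : cmod (q - 1) ^+ 2 < sin A ^+ 2 by rewrite ltr_pXn2r ?nnegrE ?cmod_ge0 ?(ltW sA0).
  by rewrite cmod_sqr; case: (q) => x y /=; rewrite subr0.
have sAI : 0 < sin A <= 1 by rewrite sA0.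
have [Rq Iq] := disc_in_sector sAI hq2.
have q0 : q != 0 by apply: contraTneq Rq => ->; rewrite ltxx.
have mq : 0 < cmod q by rewrite cmod_gt0.
have [v v1 qv] := normalize q0.
have sq : complex.Re v ^+ 2 + complex.Im v ^+ 2 = 1 by rewrite -cmod_sqr v1 expr1n.
have Rv : 0 < complex.Re v by move: Rq; rewrite {1}qv ReZ pmulr_rgt0.
have ImZ : complex.Im q = cmod q * complex.Im v.
  by rewrite {1}qv; case: (v) => x y /=; rewrite mul0r addr0.
have Iv : complex.Im v ^+ 2 < sin A ^+ 2.
  move: Iq; rewrite -cmod_sqr ImZ exprMn mulrC ltr_pM2r // exprn_gt0 //.
have Iv1 : `|complex.Im v| < sin A.
  by rewrite -(@ltr_pXn2r _ 2) ?nnegrE ?(ltW sA0) // real_normK ?num_real.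
have vI : -1 <= complex.Im v <= 1 by rewrite -ler_norml (le_trans (ltW Iv1)).
pose b := asin (complex.Im v).
have sb : sin b = complex.Im v by exact: asinK.
have cb : cos b = complex.Re v.
  rewrite cos_asin // -[RHS]ger0_norm ?(ltW Rv) // -sqrtr_sqr; congr Num.sqrt; lra.
have bI : - (pi / 2) <= b <= pi / 2 by rewrite asin_geNpi2 ?asin_lepi2.
have bA : - A < b < A.
  case/andP: bI => b1 b2; move: Iv1; rewrite ltr_norml => /andP[i1 i2].
  apply/andP; split.
    by rewrite -ltr_sin ?in_itv /= ?b1 ?b2 ?sinN ?sb //; apply/andP; split; lra.
  by rewrite -ltr_sin ?in_itv /= ?b1 ?b2 ?sb //; apply/andP; split; lra.
have [a ha] := is_arg_exists w0.
split.
  rewrite !cmodE -[0]/((0:R)%:C) -(rmorph_nat (real_complex R) 2) -rmorphM !ltcR.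
  have e := cmodM q w; rewrite -zq in e; rewrite e mulr_gt0 //=.
  rewrite -e; have := cmodD (z - w) w; rewrite subrK.
  have : sin A * cmod w <= cmod w by rewrite ler_piMl // ltW.
  lra.
exists a, (a + b); split => //.
  apply/is_argE; rewrite cisD.
  have -> : cis b = v by rewrite /cis sb cb; case: (v).
  have e := cmodM q w; rewrite -zq in e; rewrite e rmorphM /= {1}zq {1}qv.
  by have /is_argE := ha; move=> {1}->; ring.
by case/andP: bA => b1 b2; apply/andP; split; lra.
Qed.

Lemma wedge_shrink A w (s : R) : 0 < s <= 1 -> wedge A (s%:C * w) `<=` wedge A w.
Proof.
move=> /andP[s0 s1] z [/andP[z0 z1] [a [t [ha ht hI]]]].
have sC : s%:C != 0 :> R[i] by rewrite (inj_eq (@complexI R)) gt_eqF.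
split.
  rewrite z0 /=; apply: lt_le_trans z1 _.
  rewrite !cmodE cmodM cmodR ger0_norm ?(ltW s0) //.
  rewrite -(rmorph_nat (real_complex R) 2) -!rmorphM lecR ler_pM2l //.
  by rewrite ler_piMl ?cmod_ge0.
exists a, t; split => //; apply/is_argE; have /is_argE := ha.
rewrite cmodM cmodR ger0_norm ?(ltW s0) // rmorphM -mulrA.
by move/(mulfI sC).
Qed.

End Wedge.

(** * The guided Newton iteration *)

(* The conjunct f' z_n != 0 says that the n-th Newton step is defined, division
   being total. *)
Theorem theorem1p5 (R : realType) (f : {poly R[i]}) (z0 w0 : R[i]) (A h : R)
    (g : R[i] -> R[i]) :
  0 < A <= pi / 2 ->
  inverse_branch_on f z0 (wedge A w0) g ->
  h <= sin A / 19 ->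
  `|f.[z0] - w0| < h%:C * `|w0| / 2 ->
  forall n : nat,
    let z := guided_newton f h w0 z0 in
    let w := guide h w0 in
    [/\ f^`().[z n] != 0,
        `|f.[z n] - w n| <= h%:C * `|w n| / 2
      & (g @` wedge A (w n)) (z n.+1)].
Proof.
move=> AI [_ dg fg gz0] hA hyp.
have real_half (x y : R) : x%:C * y%:C / 2 = (x * y / 2)%:C.
  by rewrite !rmorphM fmorphV /= rmorph_nat.
move: hyp; rewrite !cmodE real_half ltcR => hyp.
have [A0 A1] := andP AI.
have hw0 : 0 < h * cmod w0 by have := cmod_ge0 (f.[z0] - w0); lra.
have h0 : 0 < h.
  by rewrite ltNge; apply: contraTN hw0 => hle; rewrite -leNgt mulr_le0_ge0 // cmod_ge0.
have mw0 : 0 < cmod w0 by move: hw0; rewrite pmulr_rgt0.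
have h19 : 19 * h <= sin A by move: hA; rewrite ler_pdivlMr //; lra.
have sA1 : sin A <= 1 by exact: sin_le1.
have q0 : 0 < 1 - h by lra.
have gE n : guide h w0 n = ((1 - h) ^+ n)%:C * w0.
  by rewrite /guide rmorphXn rmorphB rmorph1.
have gS n : guide h w0 n.+1 = (1 - h)%:C * guide h w0 n.
  by rewrite !gE exprS rmorphM mulrA.
have mw n : 0 < cmod (guide h w0 n).
  by rewrite gE cmodM mulr_gt0 // cmodR normr_gt0 expf_neq0 // gt_eqF.
have near_guide n u : cmod (u - guide h w0 n) < 19 * h * cmod (guide h w0 n) ->
    wedge A (guide h w0 n) u.
  move=> hu; apply: disc_in_wedge => //; apply: lt_le_trans hu _.
  by rewrite ler_pM2r.
have in_wedge n u : wedge A (guide h w0 n) u -> wedge A w0 u.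
  rewrite gE; apply: wedge_shrink; rewrite exprn_gt0 //= exprn_ile1 //; lra.
set z := guided_newton f h w0 z0.
(* 37/2 = 19 - 1/2 *)
have branch n : cmod (f.[z n] - guide h w0 n) <= h * cmod (guide h w0 n) / 2 ->
    disc_branch f f.[z n] (37 / 2 * (h * cmod (guide h w0 n))) g.
  move=> hn.
  have inw u : cball f.[z n] (37 / 2 * (h * cmod (guide h w0 n))) u -> wedge A w0 u.
    move=> hu; apply: (in_wedge n); apply: near_guide.
    apply: le_lt_trans (cmod_tri u (guide h w0 n) f.[z n]) _.
    by move: hu; rewrite /cball; lra.
  split => u /inw hu; first exact: fg.
  by exists ('D_1 (g : R[i]^o -> R[i]^o) u); exact: derivableP (dg u hu).
have step n : g f.[z n] = z n ->
    cmod (f.[z n] - guide h w0 n) <= h * cmod (guide h w0 n) / 2 ->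
    [/\ f^`().[z n] != 0, g f.[z n.+1] = z n.+1,
        cmod (f.[z n.+1] - guide h w0 n.+1) <= h * cmod (guide h w0 n.+1) / 2
      & (g @` wedge A (guide h w0 n)) (z n.+1)].
  move=> gz hn; have br := branch n hn.
  set H := h * cmod (guide h w0 n) in hn br.
  have H0 : 0 < H by rewrite mulr_gt0.
  have hb : cball f.[z n] (37 / 2 * H) f.[z n] by rewrite /cball subrr cmod0; lra.
  have [n0 _] := branch_deriv br hb.
  have mS : cmod (guide h w0 n.+1) = (1 - h) * cmod (guide h w0 n).
    by rewrite gS cmodM cmodR gtr0_norm.
  have dS : cmod (guide h w0 n.+1 - guide h w0 n) = H.
    have -> : guide h w0 n.+1 - guide h w0 n = - h%:C * guide h w0 n.
      by rewrite gS rmorphB rmorph1; ring.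
    by rewrite cmodM cmodN cmodR gtr0_norm.
  have hw : cmod (guide h w0 n.+1 - f.[z n]) <= 3 / 2 * H.
    have := cmod_tri (guide h w0 n.+1) f.[z n] (guide h w0 n).
    by rewrite dS [cmod (guide h w0 n - _)]cmodC; lra.
  have e : g f.[z n] - (f.[z n] - guide h w0 n.+1) / f^`().[g f.[z n]] = z n.+1.
    by rewrite gz.
  have := newton_step H0 br hw; rewrite /= e => -[g1 g2 g3].
  split; first by rewrite -gz.
  - exact: g1.
  - apply: le_trans g3 _; rewrite mS.
    have : h * H <= 1 / 19 * H by rewrite ler_pM2r //; lra.
    by move: H0; rewrite /H; lra.
  - exists f.[z n.+1]; last exact: g1.
    apply: near_guide.
    have := cmod_tri f.[z n.+1] (guide h w0 n) f.[z n].
    by rewrite -mulrA -/H; move: g2 hn; lra.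
have inv n : g f.[z n] = z n /\
    cmod (f.[z n] - guide h w0 n) <= h * cmod (guide h w0 n) / 2.
  elim: n => [|n [gz hn]].
    by rewrite gE expr0 mul1r; split; last exact: ltW.
  by have [_ gz' hn' _] := step n gz hn.
move=> n; have [gz hn] := inv n; have [n0 _ _ gw] := step n gz hn.
by split => //; rewrite !cmodE real_half lecR.
Qed.
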